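(* Let $u_0(x)=x$ on $[0,1]$, and let $[\alpha,\beta]\subseteq(0,1)$. For all $t_0$ large enough and all intervals $[t_0,t_1]\subseteq[0,+\infty)$, $u_0$ is an admissible initial value on $[\alpha,\beta]\times[t_0,t_1]$. Moreover, $$|a_2-a_1|\le C\,|\partial_xu^{a_2}(1,t)-\partial_xu^{a_1}(1,t)|\qquad\text{for all } a_1,a_2\in[\alpha,\beta]\text{ and all } t\in[t_0,t_1],$$ where $$C=j_1^2\,e^{\left(\frac{j_1}{2}\right)^2\frac{t_1}{1-\beta}}.$$
   Context: For $a\in[0,1)$, $u^a$ is the solution of $\partial_t u-\partial_x((x-a)\partial_x u)=0$ in $(a,1)\times(0,\infty)$, $u(1,t)=0$, $(x-a)\partial_xu(x,t)|_{x=a}=0$, $u(x,0)=u_0(x)$ for $x\in(a,1)$; that is, $u^a(\cdot,t)=e^{tA}u_0$, where $A u=\partial_x((x-a)\partial_x u)$ on $L^2(a,1)$ has domain consisting of those $u\in L^2(a,1)$ with $\int_a^1(x-a)|\partial_xu|^2dx<\infty$, $u(1)=0$ and $(x-a)\partial_x u\in H^1(a,1)$. Set $\mu_{u_0}(a,t)=\partial_xu^a(1,t)$. A function $u_0\in C^1([0,1])$ is an admissible initial value on $K\times I$, with $K=[\alpha,\beta]\subseteq[0,1)$ and $I=[t_0,t_1]\subseteq[0,+\infty)$, if there is a constant $c>0$ with $|\mu_{u_0}(a_1,t)-\mu_{u_0}(a_2,t)|\ge c|a_1-a_2|$ for all $a_1,a_2\in K$ and $t\in I$. ''For all $t_0$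 large enough'' means: there is $T_0>0$ (which may depend on $[\alpha,\beta]$) such that the assertion holds for all $t_0\ge T_0$. $j_1$ is the smallest positive zero of the Bessel function of the first kind $J_0$. *)

(* Defs.v *)
From HB Require Import structures.
From mathcomp Require Import all_boot all_order all_algebra.
From mathcomp Require Import all_classical all_reals all_analysis.

Set Implicit Arguments.
Unset Strict Implicit.
Unset Printing Implicit Defensive.

Import Order.TTheory GRing.Theory Num.Theory.
Import numFieldNormedType.Exports.

Local Open Scope classical_set_scope.
Local Open Scope ring_scope.

Notation leb R := (@lebesgue_measure R).

(* The series converges for every x; only nonnegative integer orders occur. *)
Definition besselJ (R : realType) (nu : nat) (x : R) : R :=
  limn (series (fun k : nat =>
    (-1) ^+ k / (k`! * (k + nu)`!)%N%:R * (x / 2) ^+ (2 * k + nu)%N)).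

Definition smallest_positive_zero (R : realType) (f : R -> R) (j : R) : Prop :=
  [/\ 0 < j, f j = 0 & forall x : R, 0 < x -> f x = 0 -> j <= x].

(* L^2(a,1), represented by functions on R extended by 0 outside ]a, 1[. *)
Definition L2 (R : realType) (a : R) (f : R -> R) : Prop :=
  f \_ `]a, 1[ \in Lfun (leb R) 2%:E.

Definition L2norm (R : realType) (a : R) (f : R -> R) : \bar R :=
  ('N[leb R]_2%:E [EFin \o (f \_ `]a, 1%R[)])%E.

(* f is locally absolutely continuous on ]a, 1] with weak derivative df: f is
   the continuous representative (so that f 1 is the trace at 1), while df
   matters only up to null sets. *)
Definition weak_derivative (R : realType) (a : R) (f df : R -> R) : Prop :=
  forall x y : R, a < x -> x <= y -> y <= 1 ->
    (leb R).-integrable `[x, y] (EFin \o df) /\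
    f y - f x = \int[leb R]_(z in `[x, y]) df z.

(* f belongs to H^1(a,1), with weak derivative df. *)
Definition H1 (R : realType) (a : R) (f df : R -> R) : Prop :=
  [/\ L2 a f, L2 a df & weak_derivative a f df].

(* The graph of A: v is in D(A) and A v = w, where A v = ((x - a) v')'.
   The weak derivative dv being chosen up to null sets, the existential also
   selects the continuous representative of (x - a) v'.  The condition
   (x - a) v' = 0 at x = a follows from the finite energy. *)
Definition operA (R : realType) (a : R) (v w : R -> R) : Prop :=
  exists dv : R -> R,
    [/\ L2 a v,
        weak_derivative a v dv,
        (\int[leb R]_(x in `]a, 1%R[) ((x - a) * dv x ^+ 2)%:E < +oo)%E,
        v 1 = 0
      & H1 a (fun x => (x - a) * dv x) w].

(* u x t = (e^{tA} u0)(x), as the solution of the Cauchy problem u' = A u,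
   u(0) = u0 in L^2(a,1): continuous on [0, +oo[ with values in L^2(a,1), and,
   for t > 0, in D(A) and differentiable in L^2(a,1) with derivative A u.
   For t > 0 the function x |-> u x t is the continuous representative
   on ]a, 1]. *)
Definition solution (R : realType) (a : R) (u0 : R -> R) (u : R -> R -> R)
    : Prop :=
  [/\ forall x : R, a < x < 1 -> u x 0 = u0 x,
      forall t : R, 0 <= t -> L2 a (u^~ t),
      forall s : R, 0 <= s ->
        L2norm a (fun x => u x t - u x s)
          @[t --> within `[0, +oo[ (nbhs s)] --> 0%E
    & forall t : R, 0 < t -> exists w : R -> R,
        operA a (u^~ t) w /\
        L2norm a (fun x => h^-1 * (u x (t + h) - u x t) - w x)
          @[h --> 0^'] --> 0%E].

(* u a is the solution u^a, for every a in [0, 1[. *)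
Definition solution_family (R : realType) (u0 : R -> R) (u : R -> R -> R -> R)
    : Prop :=
  forall a : R, 0 <= a < 1 -> solution a u0 (u a).

(* The derivative d/dx u^a(1, t) is taken from the left, as u^a lives
   on ]a, 1]. *)
Definition boundary_flux (R : realType) (u : R -> R -> R -> R) (a t : R) : R :=
  lim ((h^-1 * (u a (1 + h) t - u a 1 t)) @[h --> 0^'-]).

Definition C1_01 (R : realType) (f : R -> R) : Prop :=
  exists df : R -> R,
    [/\ {within `[0, 1], continuous f},
        {within `[0, 1], continuous df}
      & forall x : R, 0 < x < 1 -> is_derive x 1 f (df x)].

(* u0 is admissible on [alpha, beta] x [t0, t1]; u is meant to be the
   solution family of u0, so that boundary_flux u is mu_{u0}. *)
Definition admissible (R : realType) (u0 : R -> R) (u : R -> R -> R -> R)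
    (alpha beta t0 t1 : R) : Prop :=
  C1_01 u0 /\
  exists2 c : R, 0 < c &
    forall a1 a2 t : R, alpha <= a1 <= beta -> alpha <= a2 <= beta ->
      t0 <= t <= t1 ->
      c * `|a1 - a2| <= `|boundary_flux u a1 t - boundary_flux u a2 t|.

(* Main.v *)
Require Import Defs.
From HB Require Import structures.
From mathcomp Require Import all_boot all_order all_algebra.
From mathcomp Require Import all_classical all_reals all_analysis.
From mathcomp Require Import measurable_realfun.
From mathcomp Require Import ring lra.

(** The point of degeneracy [a] can be moved into the initial value: the change of
    variables [x = a + (1 - a) y], with time divided by [1 - a], turns [u^a] into
    an evolution of the fixed operator [B v = (y v')'] on [(0, 1)] with initial
    value [1 - (1 - a) (1 - y)]. Let [V] be the evolution of the constant [1] and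
    [m t] the integral of [V t] over [(0, 1)].

    Everything is read off from [m], by means of two facts on [B]: it is symmetric
    ([dom_symmetric]), hence the pairing of one evolution at time [s] with another
    one at time [tau - s] does not depend on [s] ([pairing_cst]); and
    [<v, v> <= - <B v, v>] ([dom_poincare]). No spectral decomposition is used.

    - The flux at [1] is the integral of [B v]. As [1 - y] is in the domain and
      [B (1 - y) = - 1], symmetry gives the flux of [u^a] at time [t] as
      [F s = s * m' (t s) + m (t s)], where [s = 1 / (1 - a)]
      ([evolution_flux], [solution_family_flux]).

    - [m t] is the squared norm of [V (t / 2)], so that its derivatives are
      quadratic forms in [V (t / 2)], and the inequality for [B] yields
      [m <= - m' <= m''] ([mass_convex]).

    - With [z = (j1 / 2) ^ 2], the function [J_0 (j1 sqrt y)] is an eigenfunction of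
      [B] for the eigenvalue [- z], and it is not orthogonal to [1]; testing
      against it, [m t >= k e^(- z t)] for some [k > 0]
      ([mass_ge], [bessel0_eigenfunction_mass]).

    Hence [F' s = s t m'' + (t + 1) m' >= (t (s - 1) - 1) m (t s)]
    ([flux_slope]). For [a >= alpha > 0] one has [s >= 1 / (1 - alpha) > 1], and once
    [t] is large the factor in front of [m] exceeds [1 / (k j1 ^ 2)]. Since
    [t s <= t1 / (1 - beta)], the slope of [F] is then at least [1 / C], and
    [a |-> 1 / (1 - a)] expands distances.

    The analytic work lies in the regularity at the degenerate end: a function of
    the domain is bounded and its flux tends to [0] there ([operA_in_domain]), which
    makes the boundary terms vanish. The flux is merely absolutely continuous, and
    the integrations by parts rest on [is_derive_parts], where the antiderivative
    is differentiable at every point although its terms need not be. *)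

Set Implicit Arguments.
Unset Strict Implicit.
Unset Printing Implicit Defensive.

Import Order.TTheory GRing.Theory Num.Theory.
Import numFieldNormedType.Exports.

Local Open Scope classical_set_scope.
Local Open Scope ring_scope.


(** * The inner product of L2 *)

Section L2_space.
Context {R : realType}.
Implicit Types (a c : R) (f g h : R -> R).

Lemma L2P a f : L2 a f <->
  measurable_fun `]a, 1[ f /\
  (leb R).-integrable `]a, 1[ (EFin \o (fun x => f x ^+ 2)).
Proof.
split=> [Lf|[mf iff]].
- have mf : measurable_fun `]a, 1[ f.
    move: Lf; rewrite /L2 inE => /andP[/[!inE]/= mf _].
    by apply/measurable_restrictT.
  split => //; have := Lfun2_integrable_sqr Lf.
  rewrite (_ : _ \o _ = (EFin \o (fun x => f x ^+ 2)) \_ `]a, 1[); last first.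
    apply/funext => x /=; rewrite !patchE; case: ifP => //= _.
    by rewrite expr0n.
  move=> /integrable_restrict; rewrite setTI; apply => //.
rewrite /L2 inE; apply/andP; split; rewrite inE/=.
  by apply/(measurable_restrictT f (measurable_itv _)).
rewrite /finite_norm unlock poweR_lty//=.
have /integrableP[_] : (leb R).-integrable setT
    ((EFin \o (fun x => f x ^+ 2)) \_ `]a, 1[).
  by apply/integrable_restrict; rewrite ?setTI.
apply: le_lt_trans; rewrite le_eqVlt; apply/orP; left; apply/eqP.
apply: eq_integral => x _ /=; rewrite !patchE; case: ifP => _ /=.
  by rewrite powR_mulrn// normrX.
by rewrite (_ : point = 0)// !normr0 powR0.
Qed.

Lemma L2D a f g : L2 a f -> L2 a g -> L2 a (fun x => f x + g x).
Proof.
rewrite /L2 => Lf Lg.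
rewrite (_ : _ \_ _ = f \_ `]a, 1[ + g \_ `]a, 1[).
  exact: (Lfun_addr_closed _ (lee1n 2)).2.
by apply/funext => x; rewrite !fctE !patchE; case: ifP => // _; rewrite addr0.
Qed.

Lemma L2Z a c f : L2 a f -> L2 a (fun x => c * f x).
Proof.
rewrite /L2 => Lf.
rewrite (_ : _ \_ _ = c \o* (f \_ `]a, 1[)); last first.
  apply/funext => x /=; rewrite !patchE mulrC; case: ifP => // _.
  by rewrite (_ : point = 0)// mul0r.
by apply: Lfun_scale => //; rewrite ler1n.
Qed.

Lemma L2B a f g : L2 a f -> L2 a g -> L2 a (fun x => f x - g x).
Proof.
move=> Lf /(L2Z (-1)) Lg; have := L2D Lf Lg.
by under eq_fun do rewrite mulN1r.
Qed.

Lemma L2_mul_integrable a f g : L2 a f -> L2 a g ->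
  (leb R).-integrable `]a, 1[ (EFin \o (fun x => f x * g x)).
Proof.
move=> Lf Lg; have /Lfun1_integrable := Lfun2_mul_Lfun1 Lf Lg.
rewrite (_ : _ \o _ = (EFin \o (fun x => f x * g x)) \_ `]a, 1[); last first.
  apply/funext => x /=; rewrite !patchE; case: ifP => //= _.
  by rewrite mulr0.
by move=> /integrable_restrict; rewrite setTI; apply.
Qed.

Lemma L2_bounded f c : measurable_fun (`]0, 1[ : set R) f ->
  (forall x, 0 < x < 1 -> `|f x| <= c) -> L2 0 f.
Proof.
move=> mf fc; apply/L2P; split => //.
apply: (@le_integrable _ _ _ _ _ _ _ (EFin \o cst (c ^+ 2))) => //.
- by apply/measurable_EFinP; exact: measurable_funX.
- move=> x /=; rewrite in_itv/= => x01; rewrite lee_fin.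
  rewrite [leRHS]ger0_norm ?sqr_ge0// normrX lerXn2r ?nnegrE//.
    by rewrite (le_trans _ (fc _ x01)).
  exact: fc.
apply/integrableP; split; first by apply/measurable_EFinP; exact: measurable_cst.
under eq_integral => x _ do rewrite (_ : `|_|%E = cst `|c ^+ 2|%:E x)//.
rewrite integral_cst//= lebesgue_measure_itv/= lte01 EFinN.
by rewrite oppe0 adde0 mule1 ltry.
Qed.

Lemma L2_cst c : L2 0 (fun=> c).
Proof. by apply: (@L2_bounded _ `|c|) => //; exact: measurable_cst. Qed.

Lemma L2_integrable f : L2 0 f ->
  (leb R).-integrable `]0, 1[ (EFin \o f).
Proof.
move=> Lf; have := L2_mul_integrable Lf (L2_cst 1).
by under [fun x => f x * 1]eq_fun do rewrite mulr1.
Qed.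

Definition ip f g : R := \int[leb R]_(x in `]0, 1[) (f x * g x).

Lemma ipC f g : ip f g = ip g f.
Proof. by apply: eq_Rintegral => x _; rewrite mulrC. Qed.

Lemma eq_ip f f' g g' : (forall x, 0 < x < 1 -> f x = f' x) ->
  (forall x, 0 < x < 1 -> g x = g' x) -> ip f g = ip f' g'.
Proof.
by move=> ff gg; apply: eq_Rintegral => x; rewrite inE/= in_itv/= => ?;
  rewrite ff ?gg.
Qed.

Lemma ipDl f g h : L2 0 f -> L2 0 g -> L2 0 h ->
  ip (fun x => f x + g x) h = ip f h + ip g h.
Proof.
move=> Lf Lg Lh; rewrite /ip -RintegralD//; try exact: L2_mul_integrable.
by apply: eq_Rintegral => x _; rewrite mulrDl.
Qed.

Lemma ipZl c f g : L2 0 f -> L2 0 g -> ip (fun x => c * f x) g = c * ip f g.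
Proof.
move=> Lf Lg; rewrite /ip -RintegralZl//; last exact: L2_mul_integrable.
by apply: eq_Rintegral => x _; rewrite mulrA.
Qed.

Lemma ipBl f g h : L2 0 f -> L2 0 g -> L2 0 h ->
  ip (fun x => f x - g x) h = ip f h - ip g h.
Proof.
move=> Lf Lg Lh; rewrite /ip -RintegralB//; try exact: L2_mul_integrable.
by apply: eq_Rintegral => x _; rewrite mulrBl.
Qed.

Lemma ipDr f g h : L2 0 f -> L2 0 g -> L2 0 h ->
  ip h (fun x => f x + g x) = ip h f + ip h g.
Proof. by move=> Lf Lg Lh; rewrite ipC ipDl// !(ipC _ h). Qed.

Lemma ipBr f g h : L2 0 f -> L2 0 g -> L2 0 h ->
  ip h (fun x => f x - g x) = ip h f - ip h g.
Proof. by move=> Lf Lg Lh; rewrite ipC ipBl// !(ipC _ h). Qed.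

Lemma ipZr c f g : L2 0 f -> L2 0 g -> ip g (fun x => c * f x) = c * ip g f.
Proof. by move=> Lf Lg; rewrite ipC ipZl// ipC. Qed.

Lemma ip_ge0 f : 0 <= ip f f.
Proof. by apply: Rintegral_ge0 => x _; rewrite -expr2 sqr_ge0. Qed.

(** Nonnegativity of the quadratic form [|s f + t g| ^ 2]; when [ip g g = 0] it is
    affine in [t], which forces [ip f g = 0]. *)
Lemma ip_CS f g : L2 0 f -> L2 0 g -> ip f g ^+ 2 <= ip f f * ip g g.
Proof.
move=> Lf Lg.
have key s t : 0 <= s ^+ 2 * ip f f + 2 * s * t * ip f g + t ^+ 2 * ip g g.
  have := ip_ge0 (fun x => s * f x + t * g x).
  have [Lsf Ltg] := (L2Z s Lf, L2Z t Lg).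
  rewrite ipDl//; last exact: L2D.
  rewrite !ipDr// !ipZl// !ipZr//.
  by rewrite (ipC g f); congr (_ <= _); ring.
have := ip_ge0 g; rewrite le_eqVlt => /predU1P[g0|g0].
  have k1 := key (ip f g) (- (ip f f + 1)); rewrite -g0 in k1 *.
  by have := sqr_ge0 (ip f g); have := ip_ge0 f; nra.
have := key (ip g g) (- ip f g) => k1.
have k2 : ip g g * (ip f f * ip g g - ip f g ^+ 2) >= 0 by nra.
by rewrite pmulr_rge0// subr_ge0 in k2.
Qed.

Lemma ler_ip f g : L2 0 f -> L2 0 g ->
  `|ip f g| <= Num.sqrt (ip f f) * Num.sqrt (ip g g).
Proof.
move=> Lf Lg; rewrite -sqrtrM ?ip_ge0// -sqrtr_sqr ler_sqrt ?ip_CS//.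
by rewrite mulr_ge0 ?ip_ge0.
Qed.

Lemma L2normE a f : L2 a f ->
  L2norm a f = (Num.sqrt (\int[leb R]_(x in `]a, 1[) (f x * f x)))%:E.
Proof.
move=> Lf; rewrite /L2norm unlock /=.
have -> : (\int[leb R]_x (`|((f \_ `]a, 1%R[) x)%:E| `^ 2)%E =
   (\int[leb R]_(x in `]a, 1[) (f x * f x))%:E)%E.
  rewrite /Rintegral fineK; last first.
    by apply: integrable_fin_num => //; exact: L2_mul_integrable.
  rewrite [RHS]integral_mkcond; apply: eq_integral => x _.
  rewrite /= !patchE; case: ifP => _ /=.
    by rewrite powR_mulrn// real_normK ?num_real// expr2.
  by rewrite (_ : point = 0)// normr0 powR0.
rewrite poweR_EFin powR12_sqrt//.
by apply: Rintegral_ge0 => x _; rewrite -expr2 sqr_ge0.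
Qed.

(** Convergence of the extended real norm is restated for the real integral of
    the square, which is the form in which [ip] can be used. *)
Lemma L2norm_cvg0 (T : Type) (F : set_system T) {FF : Filter F}
    a (f : T -> R -> R) :
  (\forall t \near F, L2 a (f t)) ->
  L2norm a (f t) @[t --> F] --> 0%E ->
  \int[leb R]_(x in `]a, 1[) (f t x * f t x) @[t --> F] --> (0 : R).
Proof.
move=> Lf /fine_cvg /= f0.
have s0 : Num.sqrt (\int[leb R]_(x in `]a, 1[) (f t x * f t x))
    @[t --> F] --> (0 : R).
  apply: cvg_trans f0; apply: near_eq_cvg; near=> t => /=.
  by rewrite L2normE//; near: t.
have s00 := cvgM s0 s0; rewrite mulr0 in s00.
apply: cvg_trans (s00 FF); apply: near_eq_cvg.
apply: nearW => t /=; rewrite -expr2 sqr_sqrtr//.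
by apply: Rintegral_ge0 => x _; rewrite -expr2 sqr_ge0.
Unshelve. all: by end_near. Qed.

(** The inner product is jointly continuous for convergence in mean square. *)
Lemma ip_cvg (T : Type) (F : set_system T) {FF : ProperFilter F}
    (f g : T -> R -> R) (f0 g0 : R -> R) :
  (\forall t \near F, L2 0 (f t)) -> (\forall t \near F, L2 0 (g t)) ->
  L2 0 f0 -> L2 0 g0 ->
  ip (fun x => f t x - f0 x) (fun x => f t x - f0 x) @[t --> F] --> (0 : R) ->
  ip (fun x => g t x - g0 x) (fun x => g t x - g0 x) @[t --> F] --> (0 : R) ->
  ip (f t) (g t) @[t --> F] --> ip f0 g0.
Proof.
move=> Lf Lg Lf0 Lg0 ff0 gg0.
have sqrt_cvg (h : T -> R) : h t @[t --> F] --> (0 : R) ->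
    Num.sqrt (h t) @[t --> F] --> (0 : R).
  by move=> h0; rewrite -[X in _ --> X]sqrtr0; apply: continuous_cvg => //;
     exact: sqrt_continuous.
have {ff0} sf := sqrt_cvg _ ff0; have {gg0} sg := sqrt_cvg _ gg0.
set sf_ := fun t => Num.sqrt _ in sf; set sg_ := fun t => Num.sqrt _ in sg.
have bnd : sf_ t * sg_ t + sf_ t * Num.sqrt (ip g0 g0)
    + Num.sqrt (ip f0 f0) * sg_ t @[t --> F] --> (0 : R).
  rewrite (_ : 0 = 0 * 0 + 0 * Num.sqrt (ip g0 g0) + Num.sqrt (ip f0 f0) * 0);
    last by rewrite !mul0r mulr0 !addr0.
  apply: cvgD; first apply: cvgD.
  - exact: cvgM.
  - by apply: cvgM => //; exact: cvg_cst.
  - by apply: cvgM => //; exact: cvg_cst.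
apply/cvgrPdist_le => e e0; move/cvgrPdist_le : bnd => /(_ _ e0) bnd.
near=> t.
have Lft : L2 0 (f t) by near: t.
have Lgt : L2 0 (g t) by near: t.
have Lfd := L2B Lft Lf0; have Lgd := L2B Lgt Lg0.
have : `|0 - (sf_ t * sg_ t + sf_ t * Num.sqrt (ip g0 g0)
    + Num.sqrt (ip f0 f0) * sg_ t)| <= e by near: t.
rewrite sub0r normrN; apply: le_trans; apply: le_trans (ler_norm _).
rewrite (_ : ip f0 g0 - ip (f t) (g t) =
    - ip (fun x => f t x - f0 x) (fun x => g t x - g0 x)
    - ip (fun x => f t x - f0 x) g0 - ip f0 (fun x => g t x - g0 x)).
  rewrite (le_trans (ler_normB _ _))// lerD ?ler_ip//.
  by rewrite (le_trans (ler_normB _ _))// normrN lerD ?ler_ip.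
rewrite !ipBl// !ipBr//; ring.
Unshelve. all: by end_near. Qed.

End L2_space.

(** * Differentiation in mean square *)

Section L2_derivative.
Context {R : realType}.
Implicit Types (s t c : R) (U V : R -> R -> R) (w z : R -> R).

(** Membership of [U s] in L2 is required near [t] because [ip] has the default
    value [0] on functions that are not integrable: the limit alone would not
    exclude them. *)
Definition L2_is_derive t U w : Prop :=
  [/\ \forall s \near t, L2 0 (U s), L2 0 w &
   ip (fun x => h^-1 * (U (t + h) x - U t x) - w x)
      (fun x => h^-1 * (U (t + h) x - U t x) - w x) @[h --> 0^'] --> (0 : R)].

Lemma ip0l w : ip (fun=> 0) w = 0.
Proof.
rewrite /ip /Rintegral integral0_eq//= => x _.
by rewrite mul0r.
Qed.

Lemma cvg_near (T : Type) (F : set_system T) {FF : Filter F} (f g : T -> R)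
    (l l' : R) :
  g t @[t --> F] --> l' -> l' = l -> (\forall t \near F, g t = f t) ->
  f t @[t --> F] --> l.
Proof. by move=> gl <- gf; apply: cvg_trans gl; exact: near_eq_cvg. Qed.

Lemma near_shift0 (P : R -> Prop) t : (\forall s \near t, P s) ->
  \forall h \near (0 : R)^', P (t + h).
Proof.
move=> Pt; apply: nbhs_dnbhs.
have : t + h @[h --> (0 : R)] --> t.
  rewrite -[X in _ --> X]addr0; apply: cvgD; [exact: cvg_cst|exact: cvg_id].
exact.
Qed.

Lemma continuous_shift0 (f : R -> R) t : {for t, continuous f} ->
  f (t + h) @[h --> (0 : R)^'] --> f t.
Proof.
move=> cf; have : t + h @[h --> (0 : R)^'] --> t.
  rewrite -[X in _ --> X]addr0; apply: cvgD; first exact: cvg_cst.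
  by apply: cvg_within_filter; exact: cvg_id.
by move=> /cvg_comp; apply.
Qed.

Lemma is_derive_continuous (f : R -> R) t d :
  is_derive t 1 f d -> {for t, continuous f}.
Proof.
by move=> df; apply/differentiable_continuous/derivable1_diffP; exact: ex_derive.
Qed.

Lemma is_deriveP (f : R -> R) t d :
  is_derive t 1 f d <-> h^-1 * (f (t + h) - f t) @[h --> (0 : R)^'] --> d.
Proof.
have -> : (fun h => h^-1 * (f (t + h) - f t)) =
    (fun h => h^-1 *: ((f \o shift t) h%:A - f t)).
  by apply/funext => h; rewrite /= /GRing.scale /= mulr1 (addrC h).
split=> [[df <-]//|fd].
apply: DeriveDef; first by apply/cvg_ex; eexists; exact: fd.
by apply/cvg_lim => //; exact: fd.
Qed.

Section pointwise_derive.
Variables (f g : R -> R) (x df dg : R).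
Hypotheses (fx : is_derive x 1 f df) (gx : is_derive x 1 g dg).

Lemma is_derive_add : is_derive x 1 (fun y => f y + g y) (df + dg).
Proof. exact: (is_deriveD fx gx). Qed.

Lemma is_derive_sub : is_derive x 1 (fun y => f y - g y) (df - dg).
Proof. exact: (is_deriveB fx gx). Qed.

Lemma is_derive_mul : is_derive x 1 (fun y => f y * g y) (f x * dg + g x * df).
Proof. exact: (is_deriveM fx gx). Qed.

Lemma is_derive_scale c : is_derive x 1 (fun y => c * f y) (c * df).
Proof. exact: (is_deriveZ c fx). Qed.

End pointwise_derive.

Lemma L2_derive_near t U w : L2_is_derive t U w ->
  \forall h \near (0 : R)^', L2 0 (fun x => h^-1 * (U (t + h) x - U t x)).
Proof.
case=> LU _ _; have LUt := nbhs_singleton LU.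
have LUh := near_shift0 LU.
near=> h; apply: L2Z; apply: L2B => //; near: h; exact: LUh.
Unshelve. all: by end_near. Qed.

Lemma L2_derive_continuous t U w : L2_is_derive t U w ->
  ip (fun x => U (t + h) x - U t x) (fun x => U (t + h) x - U t x)
    @[h --> 0^'] --> (0 : R).
Proof.
move=> dU; have Ln := L2_derive_near dU.
case: dU => LU Lw d0.
have LUt := nbhs_singleton LU; have LUh := near_shift0 LU.
have q : ip (fun x => h^-1 * (U (t + h) x - U t x))
    (fun x => h^-1 * (U (t + h) x - U t x)) @[h --> (0 : R)^'] --> ip w w.
  exact: ip_cvg.
have h2 : (h * h : R) @[h --> (0 : R)^'] --> (0 : R).
  rewrite -[X in _ --> X](mul0r 0).
  by apply: cvgM; apply: cvg_within_filter; exact: cvg_id.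
rewrite -[X in _ --> X](mul0r (ip w w)).
apply: cvg_trans (cvgM h2 q); apply: near_eq_cvg.
near=> h => /=.
have h0 : h != 0 by near: h; exact: nbhs_dnbhs_neq.
have LUB : L2 0 (fun x => U (t + h) x - U t x).
  by apply: L2B => //; near: h; exact: LUh.
rewrite ipZl//; last exact: L2Z.
by rewrite ipZr//; field.
Unshelve. all: by end_near. Qed.

(** Leibniz rule for the inner product of two curves. *)
Lemma is_derive_ip t U V w z : L2_is_derive t U w -> L2_is_derive t V z ->
  is_derive t 1 (fun s => ip (U s) (V s)) (ip w (V t) + ip (U t) z).
Proof.
move=> dU dV; have LnU := L2_derive_near dU; have LnV := L2_derive_near dV.
have cV := L2_derive_continuous dV.
case: dU => LU Lw dU; case: dV => LV Lz dV.
have LUt := nbhs_singleton LU; have LVt := nbhs_singleton LV.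
have LUh := near_shift0 LU; have LVh := near_shift0 LV.
have c1 : ip (fun x => h^-1 * (U (t + h) x - U t x)) (V (t + h))
    @[h --> (0 : R)^'] --> ip w (V t).
  exact: ip_cvg.
have UU0 : ip (fun x => U t x - U t x) (fun x => U t x - U t x)
    @[h --> (0 : R)^'] --> (0 : R).
  rewrite (_ : ip _ _ = 0); first exact: cvg_cst.
  by rewrite ipBl ?subrr//; exact: L2B.
have c2 : ip (U t) (fun x => h^-1 * (V (t + h) x - V t x))
    @[h --> (0 : R)^'] --> ip (U t) z.
  by apply: ip_cvg => //; exact: nearW.
apply/is_deriveP; apply: (cvg_near (cvgD c1 c2)) => //; near=> h => /=.
have LUth : L2 0 (U (t + h)) by near: h; exact: LUh.
have LVth : L2 0 (V (t + h)) by near: h; exact: LVh.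
rewrite ipZl//; last exact: L2B.
rewrite ipZr//; last exact: L2B.
by rewrite ipBl// ipBr//; ring.
Unshelve. all: by end_near. Qed.

Lemma cvg_mulr_dnbhs0 c : c != 0 -> c * h @[h --> (0 : R)^'] --> (0 : R)^'.
Proof.
move=> c0 P [/= e e0 Pe]; exists (e / `|c|).
  by rewrite /= divr_gt0 ?normr_gt0.
move=> h /=; rewrite sub0r normrN => he h0; apply: Pe => /=.
  by rewrite sub0r normrN normrM mulrC -ltr_pdivlMr ?normr_gt0.
by rewrite mulf_neq0.
Qed.

Lemma L2_derive_affine t c b U w : c != 0 -> L2_is_derive (c * t + b) U w ->
  L2_is_derive t (fun s => U (c * s + b)) (fun x => c * w x).
Proof.
move=> c0 [LU Lw dU]; split; last first.
- apply: (cvg_near (cvgM (cvg_cst (c ^+ 2))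
    (cvg_comp _ _ (cvg_mulr_dnbhs0 c0) dU))); first by rewrite mulr0.
  have LUt := nbhs_singleton LU.
  have LUh : \forall h \near (0 : R)^', L2 0 (U (c * t + b + c * h)).
    have := near_shift0 LU; exact: cvg_mulr_dnbhs0.
  near=> h => /=.
  have h0 : h != 0 by near: h; exact: nbhs_dnbhs_neq.
  have LUch : L2 0 (U (c * t + b + c * h)).
    by near: h.
  have Ld : L2 0 (fun x => (c * h)^-1 * (U (c * t + b + c * h) x
      - U (c * t + b) x) - w x).
    by apply: L2B => //; apply: L2Z; exact: L2B.
  have argE : c * (t + h) + b = c * t + b + c * h by ring.
  rewrite [RHS](@eq_ip _ _ (fun x => c * ((c * h)^-1 * (U (c * t + b + c * h) x
      - U (c * t + b) x) - w x)) _ (fun x => c * ((c * h)^-1 *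
      (U (c * t + b + c * h) x - U (c * t + b) x) - w x))); last 2 first.
  - by move=> x _; rewrite argE; field; apply/andP.
  - by move=> x _; rewrite argE; field; apply/andP.
  rewrite ipZl//; last exact: L2Z.
  by rewrite ipZr// mulrA.
- exact: L2Z.
have cc : c * s + b @[s --> t] --> c * t + b.
  apply: cvgD; last exact: cvg_cst.
  by apply: cvgM; [exact: cvg_cst|exact: cvg_id].
exact: (cc _ LU).
Unshelve. all: by end_near. Qed.

Lemma ip_lin_cvg0 (T : Type) (F : set_system T) {FF : ProperFilter F}
    (f g : T -> R -> R) a b :
  (\forall t \near F, L2 0 (f t)) -> (\forall t \near F, L2 0 (g t)) ->
  ip (f t) (f t) @[t --> F] --> (0 : R) ->
  ip (g t) (g t) @[t --> F] --> (0 : R) ->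
  ip (fun x => a * f t x + b * g t x) (fun x => a * f t x + b * g t x)
    @[t --> F] --> (0 : R).
Proof.
move=> Lf Lg f0 g0.
have sub0 (h : T -> R -> R) : ip (h t) (h t) @[t --> F] --> (0 : R) ->
    ip (fun x => h t x - 0) (fun x => h t x - 0) @[t --> F] --> (0 : R).
  move=> h0; apply: (cvg_near h0) => //; apply: filterE => t.
  by apply: eq_ip => x _; rewrite subr0.
have fg : ip (f t) (g t) @[t --> F] --> (0 : R).
  rewrite -[X in _ --> X](ip0l (fun=> 0)).
  by apply: ip_cvg => //; try exact: L2_cst; exact: sub0.
apply: (cvg_near (cvgD (cvgD (cvgM (cvg_cst (a ^+ 2)) f0)
  (cvgM (cvg_cst (2 * a * b)) fg)) (cvgM (cvg_cst (b ^+ 2)) g0))).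
  by rewrite !mulr0 !addr0.
near=> t; rewrite !fctE /=.
have Lft : L2 0 (f t) by near: t.
have Lgt : L2 0 (g t) by near: t.
have [Laf Lbg] := (L2Z a Lft, L2Z b Lgt).
rewrite ipDl//; last exact: L2D.
rewrite !ipDr// !ipZl//.
by rewrite !ipZr// (ipC (g t) (f t)); ring.
Unshelve. all: by end_near. Qed.

Lemma L2_derive_lin t a b U V w z : L2_is_derive t U w -> L2_is_derive t V z ->
  L2_is_derive t (fun s x => a * U s x + b * V s x)
                 (fun x => a * w x + b * z x).
Proof.
move=> dU dV; have LnU := L2_derive_near dU; have LnV := L2_derive_near dV.
case: dU => LU Lw dU; case: dV => LV Lz dV.
have near_sub (W : R -> R -> R) y : L2 0 y ->
    (\forall h \near (0 : R)^', L2 0 (fun x => h^-1 * W h x)) ->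
    \forall h \near (0 : R)^', L2 0 (fun x => h^-1 * W h x - y x).
  by move=> Ly; apply: filterS => h ?; exact: L2B.
split; last first.
- apply: (cvg_near (ip_lin_cvg0 a b (near_sub _ _ Lw LnU) (near_sub _ _ Lz LnV)
    dU dV)) => //.
  by apply: filterE => h; apply: eq_ip => x _; ring.
- by apply: L2D; exact: L2Z.
near=> s; apply: L2D; apply: L2Z; near: s; [exact: LU|exact: LV].
Unshelve. all: by end_near. Qed.

End L2_derivative.

(** * Indefinite integrals and integration by parts *)

Section indefinite_integral.
Context {R : realType}.
Implicit Types (a b x y z : R) (f g w F G : R -> R).

Local Notation pint a f x := (parameterized_integral (leb R) a x f).

Lemma near_cc a b y : a < y < b -> \forall z \near y, a <= z <= b.
Proof.
move=> yab; have : y \in `]a, b[ by rewrite in_itv.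
move=> /near_in_itvoo; apply: filterS => z; rewrite in_itv/= => /andP[az zb].
by rewrite !ltW.
Qed.

Lemma integrable_oo_cc a b f :
  (leb R).-integrable `]a, b[ (EFin \o f) ->
  (leb R).-integrable `[a, b] (EFin \o f).
Proof.
move=> /integrableP[mf foo]; apply/integrableP; split.
  by apply/emeasurable_fun_itv_bndo_bndcP/emeasurable_fun_itv_obnd_cbndP.
by rewrite integral_itv_bndoo//; exact: measurableT_comp.
Qed.

Lemma Rintegral_oo_cc a b f :
  (leb R).-integrable `]a, b[ (EFin \o f) ->
  \int[leb R]_(x in `[a, b]) f x = \int[leb R]_(x in `]a, b[) f x.
Proof.
move=> /integrableP[mf foo].
by rewrite /Rintegral integral_itv_bndoo.
Qed.

Lemma integrable_subcc a b x y f : a <= x -> y <= b ->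
  (leb R).-integrable `[a, b] (EFin \o f) ->
  (leb R).-integrable `[x, y] (EFin \o f).
Proof.
move=> ax yb; apply: integrableS => //.
by apply: subset_itv; rewrite bnd_simp.
Qed.

Lemma pintB a b f x y : a <= x -> x <= y -> y <= b ->
  (leb R).-integrable `[a, b] (EFin \o f) ->
  pint a f y - pint a f x = \int[leb R]_(z in `[x, y]) f z.
Proof.
move=> ax xy yb intf.
rewrite /parameterized_integral Rintegral_itvB//; last 1 first.
- exact: integrable_subcc intf.
rewrite Rintegral_itv_obnd_cbnd//.
apply: integrableS intf => //.
by apply: subset_itv; rewrite bnd_simp.
Qed.

Lemma pint_continuous a b f : a <= b ->
  (leb R).-integrable `[a, b] (EFin \o f) ->
  {within `[a, b], continuous (fun x => pint a f x)}.
Proof. exact: parameterized_integral_continuous. Qed.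

Lemma pint_continuous_at a b f x : a < x < b ->
  (leb R).-integrable `[a, b] (EFin \o f) ->
  {for x, continuous (fun x => pint a f x)}.
Proof.
move=> /andP[ax xb] /pint_continuous -/(_ (ltW (lt_trans ax xb))).
move=> /(continuous_within_itvP _ (lt_trans ax xb))[+ _ _]; apply.
by rewrite in_itv/= ax.
Qed.

Lemma within_continuous_pint a b F w : a <= b ->
  (leb R).-integrable `[a, b] (EFin \o w) ->
  (forall z, a <= z <= b -> F z - F a = pint a w z) ->
  {within `[a, b], continuous F}.
Proof.
move=> ab iw Fw.
apply: (@subspace_eq_continuous _ _ _ (fun z => F a + pint a w z)).
  move=> z; rewrite inE/= in_itv/= => zab.
  by rewrite /from_subspace/= -Fw// subrKC.
move=> z; apply: cvgD; first exact: cvg_cst.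
exact: (pint_continuous ab iw).
Qed.

(** The increments of the indefinite integral of [w * g] are controlled by
    those of the indefinite integral of [|w|]. *)
Lemma pint_mul_le a b w g x y M : a <= x -> x <= y -> y <= b ->
  (leb R).-integrable `[a, b] (EFin \o w) ->
  (leb R).-integrable `[a, b] (EFin \o (fun z => w z * g z)) ->
  (forall z, x <= z <= y -> `|g z| <= M) ->
  `|pint a (fun z => w z * g z) y - pint a (fun z => w z * g z) x| <=
  M * (pint a (fun z => `|w z|) y - pint a (fun z => `|w z|) x).
Proof.
move=> ax xy yb iw iwg gM.
have iwn : (leb R).-integrable `[a, b] (EFin \o (fun z => `|w z|)).
  exact: integrable_abse iw.
rewrite (pintB ax xy yb)// (pintB ax xy yb)//.
have iwxy := integrable_subcc ax yb iwn.
rewrite -RintegralZl//.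
apply: le_trans (le_normr_Rintegral _ _) _ => //.
  exact: integrable_subcc iwg.
apply: le_Rintegral => //.
- have := integrable_subcc ax yb iwg; exact: integrable_abse.
- exact: (integrableZl _ M iwxy).
move=> z; rewrite /= in_itv/= => zxy.
by rewrite normrM mulrC ler_wpM2r// gM.
Qed.

(** Integration by parts without any integral of the right-hand side: if [F]
    is absolutely continuous with derivative [w], the difference of [F * G] and
    the integral of [w * G] is differentiable at every point where [G] is, even
    though [F] itself is only differentiable almost everywhere. *)
Lemma is_derive_parts a b w F G y dG : a < y < b ->
  (leb R).-integrable `[a, b] (EFin \o w) ->
  (leb R).-integrable `[a, b] (EFin \o (fun z => w z * G z)) ->
  (forall z, a <= z <= b -> F z - F a = pint a w z) ->
  is_derive y 1 G dG ->
  is_derive y 1 (fun z => F z * G z - pint a (fun z => w z * G z) z) (F y * dG).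
Proof.
move=> /andP[ay yb] iw iwG Fw dGy.
pose J x := pint a (fun z => w z * (G z - G y)) x.
pose W x := pint a (fun z => `|w z|) x.
pose K z := F z * G z - pint a (fun z => w z * G z) z.
have iwGy : (leb R).-integrable `[a, b] (EFin \o (fun z => w z * G y)).
  exact: (integrableZr _ (G y) iw).
have iwg : (leb R).-integrable `[a, b] (EFin \o (fun z => w z * (G z - G y))).
  under [fun z => w z * _]eq_fun do rewrite mulrBr.
  exact: (integrableB _ iwG iwGy).
have iwn : (leb R).-integrable `[a, b] (EFin \o (fun z => `|w z|)).
  exact: integrable_abse iw.
have KE z : a <= z <= b -> K z = F z * (G z - G y) - J z + G y * F a.
  move=> /andP[az zb]; have sub f := @integrable_subcc a b a z f (lexx a) zb.
  have -> : J z = pint a (fun z => w z * G z) z - G y * (F z - F a).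
    rewrite Fw ?az// mulrC /J /parameterized_integral.
    rewrite -RintegralZr//; last exact: sub.
    rewrite -RintegralB//; [|exact: sub..].
    by apply: eq_Rintegral => x _; rewrite mulrBr.
  by rewrite /K; ring.
have cF : F (y + h) @[h --> (0 : R)^'] --> F y.
  have /(continuous_within_itvP _ (lt_trans ay yb))[cF _ _] :=
    within_continuous_pint (ltW (lt_trans ay yb)) iw Fw.
  by apply: continuous_shift0; apply: cF; rewrite in_itv/= ay.
have qG := (is_deriveP G y dG).1 dGy.
have nb : \forall h \near (0 : R)^', a <= y + h <= b.
  apply: (near_shift0 (P := fun z => a <= z <= b)).
  by apply: near_cc; rewrite ay.
have qJ : h^-1 * (J (y + h) - J y) @[h --> (0 : R)^'] --> (0 : R).
  pose M := `|dG| + 1.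
  have cW : W (y + h) - W y @[h --> (0 : R)^'] --> (0 : R).
    rewrite -[X in _ --> X](subrr (W y)); apply: cvgB; last exact: cvg_cst.
    by apply: continuous_shift0; apply: (pint_continuous_at _ iwn); rewrite ay.
  have lipG : \forall h \near (0 : R)^', `|G (y + h) - G y| <= M * `|h|.
    have : \forall h \near (0 : R)^', `|h^-1 * (G (y + h) - G y)| <= M.
      by apply: (cvgr_norm_le _ qG); rewrite /M ltrDl ltr01.
    move=> bq; near=> h; have h0 : h != 0 by near: h; exact: nbhs_dnbhs_neq.
    have : `|h^-1 * (G (y + h) - G y)| <= M by near: h.
    by rewrite normrM normfV ler_pdivrMl ?normr_gt0// mulrC.
  have {lipG} [d d0 lipG] : exists2 d : R, 0 < d &
      forall h, `|h| < d -> `|G (y + h) - G y| <= M * `|h|.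
    case: lipG => d /= d0 dG'; exists d => // h hd.
    have [->|h0] := eqVneq h 0; first by rewrite addr0 subrr !normr0 mulr0.
    by apply: dG' => //=; rewrite sub0r normrN.
  apply/cvgr0Pnorm_le => e e0.
  have cMW : M * `|W (y + h) - W y| @[h --> (0 : R)^'] --> (0 : R).
    rewrite -[X in _ --> X](mulr0 M); apply: cvgM; first exact: cvg_cst.
    by rewrite -[X in _ --> X](@normr0 R R); exact: cvg_norm.
  have /cvgr0Pnorm_le /(_ _ e0) Ne := cMW.
  near=> h.
  have hb : a <= y + h <= b by near: h.
  have h0 : h != 0 by near: h; exact: nbhs_dnbhs_neq.
  have hd : `|h| < d by near: h; exact: dnbhs0_lt.
  have : `|M * `|W (y + h) - W y| | <= e by near: h.
  apply: le_trans; rewrite normrM normfV ler_pdivrMl ?normr_gt0//.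
  have M0 : 0 <= M by rewrite addr_ge0.
  rewrite (ger0_norm (mulr_ge0 M0 (normr_ge0 _))) mulrA (mulrC `|h|).
  have /andP[ha hb'] := hb.
  have lipGz z : `|z - y| <= `|h| -> `|G z - G y| <= M * `|h|.
    move=> zh; rewrite -(subrKC y z); apply: le_trans (lipG _ _) _.
      exact: le_lt_trans hd.
    by rewrite ler_wpM2l.
  have [hp|hn] := leP 0 h.
  - have yh : y <= y + h by rewrite lerDl.
    apply: (le_trans (pint_mul_le (M := M * `|h|) (ltW ay) yh hb' iw iwg _)).
      by move=> z /andP[yz zh]; apply: lipGz; rewrite ger0_norm ?subr_ge0//;
        rewrite ger0_norm// lerBlDl.
    by rewrite ler_wpM2l ?ler_norm// mulr_ge0.
  - have yh : y + h <= y by rewrite gerDl ltW.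
    rewrite distrC (distrC (W _)).
    apply: (le_trans (pint_mul_le (M := M * `|h|) ha yh (ltW yb) iw iwg _)).
      by move=> z /andP[hz zy]; apply: lipGz; rewrite ler0_norm ?subr_le0//;
        rewrite ltr0_norm// opprB lerBlDr addrC -lerBlDr opprK.
    by rewrite ler_wpM2l ?ler_norm// mulr_ge0.
apply/is_deriveP; rewrite -[X in _ --> X]subr0.
apply: (cvg_near (cvgB (cvgM cF qG) qJ)) => //; near=> h.
have hb : a <= y + h <= b by near: h.
have yab : a <= y <= b by rewrite !ltW.
rewrite [RHS](_ : _ = h^-1 * (K (y + h) - K y))// !KE//.
by rewrite !fctE /=; ring.
Unshelve. all: by end_near. Qed.

End indefinite_integral.

(** * The degenerate operator on (0, 1) *)

Section diffusion_operator.
Context {R : realType}.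
Implicit Types (a b c x y z e : R) (v f w : R -> R).

Local Notation pint a f x := (parameterized_integral (leb R) a x f).

(** A pointwise description of [w = (y v')'] for [v] in the domain of the
    operator with [a = 0]. The flux [f y = y * v' y] is a separate function
    because it extends continuously to [0] and [1], where [v'] may not exist, and
    because [f 1] is the quantity to be computed. *)
Record in_domain v f w : Prop := InDomain {
  dom_L2 : L2 0 v ;
  dom_L2A : L2 0 w ;
  dom_trace : v 1 = 0 ;
  dom_left_continuous : v y @[y --> 1^'-] --> (0 : R) ;
  dom_derive : forall y, 0 < y < 1 -> is_derive y 1 v (f y / y) ;
  dom_flux : forall x y, 0 < x -> x <= y -> y <= 1 ->
    f y - f x = \int[leb R]_(z in `[x, y]) w z ;
  dom_flux0 : f y @[y --> 0^'+] --> (0 : R) ;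
  dom_bounded : exists c, forall y, 0 < y < 1 -> `|v y| <= c }.

Lemma L2_integrable_cc e w : 0 <= e -> L2 0 w ->
  (leb R).-integrable `[e, 1] (EFin \o w).
Proof.
move=> e0 /L2_integrable /integrable_oo_cc; exact: integrable_subcc.
Qed.

Lemma L2M_integrable_cc e v w : 0 <= e -> L2 0 v -> L2 0 w ->
  (leb R).-integrable `[e, 1] (EFin \o (fun x => v x * w x)).
Proof.
move=> e0 Lv Lw; apply: (@integrable_subcc _ 0 1) => //.
exact/integrable_oo_cc/L2_mul_integrable.
Qed.

Lemma cvg_pint0 g : (leb R).-integrable `]0, 1[ (EFin \o g) ->
  pint e g 1 @[e --> 0^'+] --> \int[leb R]_(x in `]0, 1[) g x.
Proof.
move=> ig; have icc := integrable_oo_cc ig.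
rewrite -(Rintegral_oo_cc ig).
have h : pint 0 g 1 - pint 0 g e @[e --> 0^'+] --> pint 0 g 1 - 0.
  apply: cvgB; first exact: cvg_cst.
  apply: cvg_at_right_filter.
  exact: (parameterized_integral_cvg_left ltr01 icc).
apply: (cvg_near h); first by rewrite subr0.
near=> e; rewrite (@pintB _ 0 1)//.
by near: e; exact: nbhs_right_le.
Unshelve. all: by end_near. Qed.

Section on_domain.
Context v f w (dom : in_domain v f w).

Lemma dom_flux_continuous e : 0 < e -> e < 1 ->
  {within `[e, 1], continuous f}.
Proof.
move=> e0 e1; apply: (within_continuous_pint (w := w) (ltW e1)).
  exact: L2_integrable_cc (ltW e0) (dom_L2A dom).
by move=> z /andP[ez z1]; rewrite (dom_flux dom).
Qed.

Lemma dom_continuous_at y : 0 < y < 1 -> {for y, continuous v}.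
Proof.
by move=> y01; exact: (is_derive_continuous (dom_derive dom y01)).
Qed.

Lemma dom_continuous e : 0 < e -> e < 1 -> {within `[e, 1], continuous v}.
Proof.
move=> e0 e1; apply/continuous_within_itvP => //; split.
- move=> y; rewrite in_itv/= => /andP[ey y1]; apply: dom_continuous_at.
  by rewrite y1 (lt_trans e0).
- by apply: cvg_at_right_filter; apply: dom_continuous_at; rewrite e0.
- by rewrite (dom_trace dom); exact: dom_left_continuous dom.
Qed.

(** As the flux vanishes at [0], the flux at [1] is the integral of [w]. *)
Lemma dom_fluxE : f 1 = ip w (fun=> 1).
Proof.
have iw := L2_integrable (dom_L2A dom).
have -> : ip w (fun=> 1) = \int[leb R]_(x in `]0, 1[) w x.
  by apply: eq_Rintegral => x _; rewrite mulr1.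
have h1 := cvg_pint0 iw.
have h2 : pint e w 1 @[e --> 0^'+] --> f 1.
  have h : f 1 - f e @[e --> 0^'+] --> f 1 - 0.
    by apply: cvgB; [exact: cvg_cst|exact: dom_flux0 dom].
  apply: (cvg_near h); first by rewrite subr0.
  near=> e; rewrite /parameterized_integral -(dom_flux dom)//; near: e.
  exact: nbhs_right_le.
exact: cvg_unique h2 h1.
Unshelve. all: by end_near. Qed.

End on_domain.

Lemma dom_flux_pint v f w e y : in_domain v f w -> 0 < e -> e <= y <= 1 ->
  f y - f e = pint e w y.
Proof. by move=> dom e0 /andP[ey y1]; rewrite (dom_flux dom). Qed.

Section two_functions.
Context v1 f1 w1 v2 f2 w2 (dom1 : in_domain v1 f1 w1)
  (dom2 : in_domain v2 f2 w2).

(** [f1] is only absolutely continuous, so that [f1 * v2] need not be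
    differentiable; subtracting the integral of [w1 * v2] leaves the part that
    comes from differentiating [v2]. *)
Let K e y := f1 y * v2 y - pint e (fun z => w1 z * v2 z) y.

Lemma is_derive_flux_mul e y : 0 < e -> e < y < 1 ->
  is_derive y 1 (K e) (f1 y * (f2 y / y)).
Proof.
move=> e0 ey1; have /andP[ey y1] := ey1; apply: (is_derive_parts ey1).
- exact: L2_integrable_cc (ltW e0) (dom_L2A dom1).
- exact: L2M_integrable_cc (ltW e0) (dom_L2A dom1) (dom_L2 dom2).
- by move=> z; exact: (dom_flux_pint dom1 e0).
- by apply: (dom_derive dom2); rewrite y1 (lt_trans e0).
Qed.

Lemma flux_mul_continuous e : 0 < e -> e < 1 ->
  {within `[e, 1], continuous (K e)}.
Proof.
move=> e0 e1 z; apply: cvgB.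
  apply: cvgM; first exact: (dom_flux_continuous dom1 e0 e1).
  exact: (dom_continuous dom2 e0 e1).
apply: (pint_continuous (ltW e1)).
exact: L2M_integrable_cc (ltW e0) (dom_L2A dom1) (dom_L2 dom2).
Qed.

Lemma flux_mul_cvg0 : f1 e * v2 e @[e --> 0^'+] --> (0 : R).
Proof.
have [c vc] := dom_bounded dom2.
have h : `|f1 e| * c @[e --> 0^'+] --> (0 : R).
  rewrite -[X in _ --> X](mul0r c); apply: cvgM; last exact: cvg_cst.
  rewrite -[X in _ --> X](@normr0 R R).
  by apply: cvg_norm; exact: dom_flux0 dom1.
apply/cvgr0Pnorm_le => d d0; move/cvgrPdist_le : h => /(_ _ d0) h.
near=> e.
have : `|0 - `|f1 e| * c| <= d by near: e.
rewrite sub0r normrN; apply: le_trans; apply: le_trans (ler_norm _).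
by rewrite normrM ler_wpM2l// vc//; apply/andP; split => //; near: e;
  exact: nbhs_right_lt.
Unshelve. all: by end_near. Qed.

End two_functions.

(** Symmetry of the operator: the Wronskian [f1 * v2 - f2 * v1] vanishes at
    both ends of the interval. *)
Lemma dom_symmetric v1 f1 w1 v2 f2 w2 :
  in_domain v1 f1 w1 -> in_domain v2 f2 w2 -> ip w1 v2 = ip v1 w2.
Proof.
move=> dom1 dom2; rewrite (ipC v1).
pose g1 z := w1 z * v2 z; pose g2 z := w2 z * v1 z.
have i1 := L2_mul_integrable (dom_L2A dom1) (dom_L2 dom2).
have i2 := L2_mul_integrable (dom_L2A dom2) (dom_L2 dom1).
have cst_wronskian e : 0 < e -> e < 1 ->
    pint e g1 1 - pint e g2 1 = f2 e * v1 e - f1 e * v2 e.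
  move=> e0 e1.
  pose D y := (f1 y * v2 y - pint e g1 y) - (f2 y * v1 y - pint e g2 y).
  have dD y : y \in `]e, 1[ -> is_derive y 1 D 0.
    rewrite in_itv/= => ey1.
    have d1 := is_derive_flux_mul dom1 dom2 e0 ey1.
    have d2 := is_derive_flux_mul dom2 dom1 e0 ey1.
    have -> : 0 = f1 y * (f2 y / y) - f2 y * (f1 y / y) by ring.
    exact: is_deriveB.
  have cD : {within `[e, 1], continuous D}.
    by move=> z; apply: cvgB;
      [exact: (flux_mul_continuous dom1 dom2 e0 e1)
      |exact: (flux_mul_continuous dom2 dom1 e0 e1)].
  have [z _] := MVT e1 dD cD; rewrite mul0r => /eqP; rewrite subr_eq0 => /eqP.
  have -> : D 1 = pint e g2 1 - pint e g1 1.
    by rewrite /D (dom_trace dom1) (dom_trace dom2); ring.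
  have -> : D e = f1 e * v2 e - f2 e * v1 e.
    by rewrite /D /parameterized_integral set_itv1 !Rintegral_set1 !subr0.
  by move=> DE; lra.
have h1 : pint e g1 1 - pint e g2 1 @[e --> 0^'+] --> ip w1 v2 - ip w2 v1.
  by apply: cvgB; exact: cvg_pint0.
have h2 : pint e g1 1 - pint e g2 1 @[e --> 0^'+] --> (0 : R).
  have h : f2 e * v1 e - f1 e * v2 e @[e --> 0^'+] --> (0 - 0 : R).
    by apply: cvgB; [exact: flux_mul_cvg0 dom2 dom1|exact: flux_mul_cvg0 dom1 dom2].
  apply: (cvg_near h); first by rewrite subr0.
  near=> e; rewrite -cst_wronskian//; near: e; exact: nbhs_right_lt.
by apply/eqP; rewrite -subr_eq0; apply/eqP; exact: cvg_unique h1 h2.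
Unshelve. all: by end_near. Qed.

(** Jacobi's trick: with [th = y / (c - y)], the function [f * v + th * v ^ 2] is
    an antiderivative of [w * v + v ^ 2 / (c - y) + (f + th * v) ^ 2 / y], and
    [1 / (c - y) >= 1 / c]. The factor [th] is [- y * p' / p] for the positive
    function [p = c - y], which satisfies [- (y p')' = 1 >= p / c]. Taking
    [1 < c] keeps [p] away from [0] up to the end [y = 1]. *)
Lemma dom_poincare_aux v f w c : in_domain v f w -> 1 < c ->
  c^-1 * ip v v <= - ip w v.
Proof.
move=> dom c1; have c0 : 0 < c by rewrite (lt_trans ltr01).
pose th y : R := y / (c - y).
pose g y := w y * v y; pose q y := v y * v y.
have ig := L2_mul_integrable (dom_L2A dom) (dom_L2 dom).
have iq := L2_mul_integrable (dom_L2 dom) (dom_L2 dom).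
have mono e : 0 < e -> e < 1 ->
    f e * v e + th e * (v e * v e) <= - pint e g 1 - c^-1 * pint e q 1.
  move=> e0 e1.
  pose D y := (f y * v y - pint e g y) + th y * (v y * v y) - c^-1 * pint e q y.
  have dD y : y \in `]e, 1[ -> is_derive y 1 D
      ((f y + th y * v y) ^+ 2 / y + (v y) ^+ 2 * ((c - y)^-1 - c^-1)).
    rewrite in_itv/= => ey1; have /andP[ey y1] := ey1.
    have y0 : 0 < y by rewrite (lt_trans e0).
    have cy : 0 < c - y by rewrite subr_gt0 (lt_trans y1).
    have d1 := is_derive_flux_mul dom dom e0 ey1.
    have dv : is_derive y 1 v (f y / y) by apply: (dom_derive dom); rewrite y0.
    have dth : is_derive y 1 th (c / (c - y) ^+ 2).
      have dcy : is_derive y 1 (fun y => c - y) (0 - 1).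
        exact: is_derive_sub.
      have dV := @is_deriveV _ (fun y => c - y) _ _ _ (lt0r_neq0 cy) dcy.
      apply: (is_derive_eq (is_derive_mul (is_derive_id y 1) dV)).
      by rewrite /GRing.scale /=; field; exact: lt0r_neq0.
    have dq : is_derive y 1 (fun y => pint e q y) (q y).
      have iqe : (leb R).-integrable `[e, 1] (EFin \o q).
        exact: L2M_integrable_cc (ltW e0) (dom_L2 dom) (dom_L2 dom).
      have cq : {for y, continuous q}.
        by apply: cvgM; apply: (dom_continuous_at dom); rewrite y0.
      have [dq dqE] := continuous_FTC1_closed y1 iqe ey cq.
      by apply: DeriveDef => //; rewrite -derive1E.
    have dD := is_derive_sub (is_derive_add d1
      (is_derive_mul dth (is_derive_mul dv dv))) (is_derive_scale dq c^-1).
    apply: (is_derive_eq dD); rewrite /th /q; field.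
    by rewrite !lt0r_neq0.
  have cD : {within `[e, 1], continuous D}.
    move=> z; apply: cvgB; first apply: cvgD.
    - exact: (flux_mul_continuous dom dom e0 e1).
    - have cv := dom_continuous dom e0 e1.
      have cth : {within `[e, 1], continuous th}.
        apply/continuous_in_subspaceT => x.
        rewrite inE/= in_itv/= => /andP[_ x1].
        apply: cvgM; first exact: cvg_id.
        apply: cvgV; last by apply: cvgB; [exact: cvg_cst|exact: cvg_id].
        by rewrite lt0r_neq0// subr_gt0 (le_lt_trans x1).
      by apply: cvgM; [exact: cth|apply: cvgM; exact: cv].
    - apply: cvgM; first exact: cvg_cst.
      apply: (pint_continuous (ltW e1)).
      exact: L2M_integrable_cc (ltW e0) (dom_L2 dom) (dom_L2 dom).
  have [y /[dup] ey1 + DE] := MVT e1 dD cD.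
  rewrite in_itv/= => /andP[ey y1].
  have : D e <= D 1.
    rewrite -subr_ge0 DE mulr_ge0 ?subr_ge0 ?(ltW e1)//.
    have y0 : 0 < y by rewrite (lt_trans e0).
    have cy : (c - y)^-1 - c^-1 >= 0.
      rewrite subr_ge0 lef_pV2 ?posrE ?subr_gt0 ?(lt_trans y1)//.
      by rewrite gerBl ltW.
    by apply: addr_ge0; apply: mulr_ge0 => //; rewrite ?sqr_ge0 ?invr_ge0 ?ltW.
  have -> : D 1 = - pint e g 1 - c^-1 * pint e q 1.
    by rewrite /D (dom_trace dom); ring.
  have -> // : D e = f e * v e + th e * (v e * v e).
  by rewrite /D /parameterized_integral set_itv1 !Rintegral_set1; ring.
have h1 : - pint e g 1 - c^-1 * pint e q 1 @[e --> 0^'+] -->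
    - ip w v - c^-1 * ip v v.
  apply: cvgB; first by apply: cvgN; exact: cvg_pint0.
  by apply: cvgM; [exact: cvg_cst|exact: cvg_pint0].
have h2 : f e * v e + th e * (v e * v e) @[e --> 0^'+] --> (0 : R).
  have [b vb] := dom_bounded dom.
  have h : th e * (b * b) @[e --> 0^'+] --> (0 : R).
    rewrite -[X in _ --> X](mul0r (b * b)); apply: cvgM; last exact: cvg_cst.
    apply: cvg_at_right_filter; rewrite -[X in _ --> X](mul0r (c - 0)^-1).
    apply: cvgM; first exact: cvg_id.
    apply: cvgV; last by apply: cvgB; [exact: cvg_cst|exact: cvg_id].
    by rewrite subr0 lt0r_neq0.
  rewrite -[X in _ --> X](addr0 0); apply: cvgD.
    exact: (flux_mul_cvg0 dom dom).
  apply: (squeeze_cvgr _ (cvg_cst 0) h); near=> e.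
  have e0 : 0 < e by near: e; exact: nbhs_right_gt.
  have e1 : e < 1 by near: e; exact: nbhs_right_lt.
  have the : 0 <= th e by rewrite divr_ge0 ?subr_ge0 ?ltW// (lt_trans e1).
  rewrite mulr_ge0 -?expr2 ?sqr_ge0//= ler_wpM2l// -[v e ^+ 2]real_normK ?num_real//.
  by rewrite lerXn2r ?nnegrE// ?(le_trans _ (vb e _)) ?vb ?e0.
suff : 0 <= - ip w v - c^-1 * ip v v by rewrite subr_ge0.
apply: (ler_cvg_to h2 h1); near=> e.
by apply: mono; near: e; [exact: nbhs_right_gt|exact: nbhs_right_lt].
Unshelve. all: by end_near. Qed.

(** The spectrum of the operator lies below [- 1]: let [c] tend to [1]. *)
Lemma dom_poincare v f w : in_domain v f w -> ip v v <= - ip w v.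
Proof.
move=> dom; apply/ler_addgt0Pr => e e0.
have h : c^-1 * ip v v @[c --> (1 : R)^'+] --> 1^-1 * ip v v.
  apply: cvgM; last exact: cvg_cst.
  by apply: cvg_at_right_filter; apply: cvgV => //; exact: oner_neq0.
rewrite invr1 mul1r in h.
have : ip v v <= - ip w v; last by move=> /le_trans; apply; rewrite lerDl ltW.
apply: (ler_cvg_to h (cvg_cst _)); near=> c.
by apply: dom_poincare_aux dom _; near: c; exact: nbhs_right_gt.
Unshelve. all: by end_near. Qed.

(** The one-sided derivative at the right end is the flux [f 1]. *)
Lemma dom_left_derivative v f w : in_domain v f w ->
  h^-1 * (v (1 + h) - v 1) @[h --> 0^'-] --> f 1.
Proof.
move=> dom.
have [h0 h1] : (0 : R) < 2^-1 /\ (2^-1 : R) < 1 by split; lra.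
have cf := dom_flux_continuous dom h0 h1.
have /(continuous_within_itvP _ h1)[_ _ f1] := cf.
have q1 : f y / y @[y --> 1^'-] --> f 1.
  rewrite -[X in _ --> X]divr1; apply: cvgM => //.
  apply: cvg_at_left_filter; apply: cvgV; first exact: oner_neq0.
  exact: cvg_id.
apply/cvgrPdist_le => d d0; move/cvgrPdist_le : q1 => /(_ _ d0) [r /= r0 qr].
near=> h.
have hn : h < 0 by near: h; exact: nbhs_left_lt.
have hr : - r < h by near: h; apply: nbhs_left_gt; rewrite oppr_lt0.
have hh : - 2^-1 < h by near: h; apply: nbhs_left_gt; rewrite oppr_lt0.
have h11 : 1 + h < 1 by rewrite gtrDl.
have h10 : 0 < 1 + h by lra.
have [|c + vE] := MVT h11 _ (dom_continuous dom h10 h11) (df := fun y => f y / y).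
  move=> y; rewrite in_itv/= => /andP[hy y1].
  by apply: (dom_derive dom); rewrite y1 (lt_trans h10).
rewrite in_itv/= => /andP[hc c1].
have -> : h^-1 * (v (1 + h) - v 1) = f c / c.
  rewrite -(opprB (v 1)) vE; field.
  by rewrite lt0r_neq0 ?(lt_trans h10)//= lt_eqF.
by apply: qr => //=; rewrite gtr0_norm ?subr_gt0//; lra.
Unshelve. all: by end_near. Qed.

Lemma in_domain_lin a b v1 f1 w1 v2 f2 w2 :
  in_domain v1 f1 w1 -> in_domain v2 f2 w2 ->
  in_domain (fun y => a * v1 y + b * v2 y) (fun y => a * f1 y + b * f2 y)
            (fun y => a * w1 y + b * w2 y).
Proof.
move=> dom1 dom2; split.
- by apply: L2D; apply: L2Z; [exact: dom_L2 dom1|exact: dom_L2 dom2].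
- by apply: L2D; apply: L2Z; [exact: dom_L2A dom1|exact: dom_L2A dom2].
- by rewrite (dom_trace dom1) (dom_trace dom2) !mulr0 addr0.
- have h : a * v1 y + b * v2 y @[y --> 1^'-] --> a * 0 + b * 0.
    apply: cvgD; apply: cvgM; try exact: cvg_cst.
      exact: dom_left_continuous dom1.
    exact: dom_left_continuous dom2.
  by rewrite !mulr0 addr0 in h.
- move=> y y01; have d1 := dom_derive dom1 y01; have d2 := dom_derive dom2 y01.
  have d := is_derive_add (is_derive_scale d1 a) (is_derive_scale d2 b).
  by apply: (is_derive_eq d); ring.
- move=> x y x0 xy y1.
  have i1 := integrable_subcc (lexx x) y1 (L2_integrable_cc (ltW x0) (dom_L2A dom1)).
  have i2 := integrable_subcc (lexx x) y1 (L2_integrable_cc (ltW x0) (dom_L2A dom2)).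
  rewrite RintegralD//; [|exact: (integrableZl _ a i1)|exact: (integrableZl _ b i2)].
  rewrite !RintegralZl// -(dom_flux dom1)// -(dom_flux dom2)//; ring.
- have h : a * f1 y + b * f2 y @[y --> 0^'+] --> a * 0 + b * 0.
    apply: cvgD; apply: cvgM; try exact: cvg_cst.
      exact: dom_flux0 dom1.
    exact: dom_flux0 dom2.
  by rewrite !mulr0 addr0 in h.
- have [c1 vc1] := dom_bounded dom1; have [c2 vc2] := dom_bounded dom2.
  exists (`|a| * c1 + `|b| * c2) => y y01.
  rewrite (le_trans (ler_normD _ _))// !normrM lerD// ler_wpM2l//.
    exact: vc1.
  exact: vc2.
Qed.

End diffusion_operator.

(** * Regularity of the domain *)

Section domain_of_operA.
Context {R : realType}.
Implicit Types (a b c x y z e : R) (v f w dv : R -> R).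

Local Notation pint a f x := (parameterized_integral (leb R) a x f).

(** A nonzero limit of the flux at [0] would make the energy density
    [f y ^ 2 / y] non integrable. *)
Lemma flux_limit0 f l : f y @[y --> 0^'+] --> l ->
  (leb R).-integrable `]0, 1[ (EFin \o (fun y => f y ^+ 2 / y)) -> l = 0.
Proof.
move=> fl iE; apply/eqP; apply: contraT => l0.
pose E y := f y ^+ 2 / y.
have icc : (leb R).-integrable `[0, 1] (EFin \o E) := integrable_oo_cc iE.
have E0 y : 0 < y -> 0 <= E y by move=> y0; rewrite divr_ge0 ?sqr_ge0 ?ltW.
have l2 : 0 < l ^+ 2 by rewrite exprn_even_gt0.
have f2l : \forall y \near 0^'+, l ^+ 2 / 2 <= f y ^+ 2.
  have f2 : f y * f y @[y --> 0^'+] --> l * l by apply: cvgM.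
  apply: (cvgr_ge _ f2); rewrite -expr2; lra.
have [d /= d0 fd] := f2l.
have small : pint 0 E e @[e --> 0] --> (0 : R).
  exact: (parameterized_integral_cvg_left ltr01 icc).
have l8 : 0 < l ^+ 2 / 8 by lra.
move/cvgr0Pnorm_lt : small => /(_ _ l8) [d' /= d'0 sd].
(* on [[e, 2 * e]] the density is at least [l ^ 2 / (4 * e)], hence its integral
   is at least [l ^ 2 / 4] whatever [e] *)
pose e := Num.min (Num.min d d') 1 / 4.
have m0 : 0 < Num.min (Num.min d d') 1 by rewrite !lt_min d0 d'0 ltr01.
have [md md' m1] : [/\ Num.min (Num.min d d') 1 <= d,
    Num.min (Num.min d d') 1 <= d' & Num.min (Num.min d d') 1 <= 1].
  by rewrite !ge_min !lexx !orbT.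
have e0 : 0 < e by rewrite /e; lra.
have ed : 2 * e < d by rewrite /e; lra.
have ed' : 2 * e < d' by rewrite /e; lra.
have e1 : 2 * e < 1 by rewrite /e; lra.
have ee : e <= 2 * e by lra.
have : pint 0 E (2 * e) < l ^+ 2 / 8.
  apply: le_lt_trans (ler_norm _) _; apply: sd => /=.
  by rewrite sub0r normrN gtr0_norm// mulr_gt0.
rewrite ltNge => /negP; case.
have -> : pint 0 E (2 * e) = pint 0 E e + \int[leb R]_(z in `[e, 2 * e]) E z.
  by have := pintB (ltW e0) ee (ltW e1) icc; lra.
have ie := integrable_subcc (ltW e0) (ltW e1) icc.
have p0 : 0 <= pint 0 E e.
  apply: Rintegral_ge0 => z; rewrite /= in_itv/= le_eqVlt => /andP[/predU1P[<-|z0] _].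
    by rewrite /E invr0 mulr0.
  exact: E0.
have icst : (leb R).-integrable `[e, 2 * e] (EFin \o cst (l ^+ 2 / (4 * e))).
  by apply: continuous_compact_integrable; [exact: segment_compact|
     move=> z; exact: cvg_cst].
have : \int[leb R]_(z in `[e, 2 * e]) (l ^+ 2 / (4 * e)) <= \int[leb R]_(z in `[e, 2 * e]) E z.
  apply: le_Rintegral => // z; rewrite /= in_itv/= => /andP[ez z2].
  have z0 : 0 < z by rewrite (lt_le_trans e0).
  rewrite /E ler_pdivlMr// mulrAC ler_pdivrMr ?mulr_gt0//.
  have : l ^+ 2 / 2 <= f z ^+ 2.
    by apply: fd => //=; rewrite sub0r normrN gtr0_norm// (le_lt_trans z2).
  nra.
rewrite Rintegral_cst//= lebesgue_measure_itv/= lte_fin.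
rewrite ltr_pMl// ltr1n -EFinB/= => h; apply: le_trans (lerD p0 h).
have -> : l ^+ 2 / (4 * e) * (2 * e - e) = l ^+ 2 / 4.
  by field; exact: lt0r_neq0.
lra.
Unshelve. all: by end_near. Qed.

(** The flux is the integral of [w] from [0], hence [O(sqrt y)] by
    Cauchy-Schwarz. *)
Lemma flux_sqrt_bound f w : L2 0 w ->
  (forall x y, 0 < x -> x <= y -> y <= 1 ->
    f y - f x = \int[leb R]_(z in `[x, y]) w z) ->
  f y @[y --> 0^'+] --> (0 : R) ->
  forall y, 0 < y <= 1 -> `|f y| <= (1 + ip w w) / 2 * Num.sqrt y.
Proof.
move=> Lw fw f0 y /andP[y0 y1].
have s0 : 0 < Num.sqrt y by rewrite sqrtr_gt0.
have icc : (leb R).-integrable `[0, 1] (EFin \o w).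
  exact: integrable_oo_cc (L2_integrable Lw).
have i2 : (leb R).-integrable `[0, 1] (EFin \o (fun x => w x * w x)).
  exact: integrable_oo_cc (L2_mul_integrable Lw Lw).
have bnd x : 0 < x -> x <= y ->
    `|f y - f x| <= (1 + ip w w) / 2 * Num.sqrt y.
  move=> x0 xy; rewrite fw//.
  have iw := integrable_subcc (ltW x0) y1 icc.
  have iw2 := integrable_subcc (ltW x0) y1 i2.
  (* [|w z| <= l + m * w z ^ 2], with weights that make both terms of the
     integral over [[x, y]] of order [sqrt y] *)
  pose l := (Num.sqrt y)^-1 / 2; pose m := Num.sqrt y / 2.
  have l0 : 0 < l by rewrite divr_gt0 ?invr_gt0.
  have m0 : 0 < m by rewrite divr_gt0.
  have icst : (leb R).-integrable `[x, y] (EFin \o cst l).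
    by apply: continuous_compact_integrable; [exact: segment_compact|
      move=> z; exact: cvg_cst].
  apply: le_trans (le_normr_Rintegral _ iw) _ => //.
  apply: (@le_trans _ _ (\int[leb R]_(z in `[x, y]) (l + m * (w z * w z)))).
    apply: le_Rintegral => //.
    - by have := integrable_abse iw.
    - exact: (integrableD _ icst (integrableZl _ m iw2)).
    - move=> z _; rewrite -subr_ge0.
      have -> : l + m * (w z * w z) - `|w z| = m * (`|w z| - (Num.sqrt y)^-1) ^+ 2.
        rewrite -expr2 -[w z ^+ 2]real_normK ?num_real// /l /m.
        by field; exact: lt0r_neq0.
      by rewrite mulr_ge0 ?sqr_ge0// ltW.
  rewrite RintegralD//; last exact: (integrableZl _ m iw2).
  have -> : \int[leb R]_(z in `[x, y]) (m * (w z * w z)) =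
      m * \int[leb R]_(z in `[x, y]) (w z * w z).
    by rewrite RintegralZl.
  have -> : \int[leb R]_(z in `[x, y]) l = l * (y - x).
    rewrite Rintegral_cst//= lebesgue_measure_itv/= lte_fin.
    by move: xy; rewrite le_eqVlt => /predU1P[->|->//]; rewrite ltxx subrr.
  have w2 : \int[leb R]_(z in `[x, y]) (w z * w z) <= ip w w.
    have h1 := pintB (ltW x0) xy y1 i2.
    have h2 := pintB (ltW y0) y1 (lexx 1) i2.
    have h3 : 0 <= \int[leb R]_(z in `[y, 1]) (w z * w z).
      by apply: Rintegral_ge0 => z _; rewrite -expr2 sqr_ge0.
    have h4 : 0 <= pint 0 (fun z => w z * w z) x.
      by apply: Rintegral_ge0 => z _; rewrite -expr2 sqr_ge0.
    have h5 : pint 0 (fun z => w z * w z) 1 = ip w w.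
      exact: Rintegral_oo_cc (L2_mul_integrable Lw Lw).
    rewrite -h5 -h1; apply: (le_trans (y := pint 0 (fun z => w z * w z) y)).
      by rewrite gerBl.
    by rewrite -subr_ge0 h2.
  have yE : y = Num.sqrt y ^+ 2 by rewrite sqr_sqrtr// ltW.
  have : l * (y - x) <= m.
    rewrite (@le_trans _ _ (l * y))// ?ler_wpM2l ?(ltW l0)// ?gerBl ?(ltW x0)//.
    by rewrite le_eqVlt; apply/orP; left; apply/eqP; rewrite {1}yE /l /m; field;
      exact: lt0r_neq0.
  have : m * \int[leb R]_(z in `[x, y]) (w z * w z) <= m * ip w w.
    by rewrite ler_wpM2l// ltW.
  move=> h2 h1; have -> : (1 + ip w w) / 2 * Num.sqrt y = m + m * ip w w.
    by rewrite /m; field.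
  exact: lerD.
have h : `|f y - f x| @[x --> 0^'+] --> `|f y - 0|.
  by apply: cvg_norm; apply: cvgB => //; exact: cvg_cst.
rewrite subr0 in h; apply: (ler_cvg_to h (cvg_cst _)); near=> x.
by apply: bnd; near: x; [exact: nbhs_right_gt|exact: nbhs_right_le].
Unshelve. all: by end_near. Qed.

(** Integrate [|v' y| <= c / sqrt y]: the function [v + 2 * c * sqrt y] and its
    analogue for [- v] are nondecreasing. *)
Lemma bounded_of_flux v f c : 0 <= c -> v 1 = 0 ->
  (forall y, 0 < y < 1 -> is_derive y 1 v (f y / y)) ->
  v y @[y --> 1^'-] --> (0 : R) ->
  (forall y, 0 < y <= 1 -> `|f y| <= c * Num.sqrt y) ->
  forall y, 0 < y < 1 -> `|v y| <= 2 * c.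
Proof.
move=> c0 v1 dv lv fc y /andP[y0 y1].
have s0 z : 0 < z -> 0 < Num.sqrt z by rewrite sqrtr_gt0.
(* used for [s = 1] and [s = -1] *)
have H s : `|s| <= 1 -> s * v y <= 2 * c.
  move=> s1; pose D z := s * v z + 2 * c * Num.sqrt z.
  have dD z : z \in `]y, 1[ -> is_derive z 1 D
      (s * (f z / z) + 2 * c * (2 * Num.sqrt z)^-1).
    rewrite in_itv/= => /andP[yz z1]; have z0 : 0 < z by rewrite (lt_trans y0).
    have dvz : is_derive z 1 v (f z / z) by apply: dv; rewrite z0.
    exact: (is_derive_add (is_derive_scale dvz s)
      (is_derive_scale (is_derive1_sqrt z0) (2 * c))).
  have cv x : 0 < x < 1 -> {for x, continuous v}.
    by move=> /dv; exact: is_derive_continuous.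
  have cD : {within `[y, 1], continuous D}.
    apply/continuous_within_itvP => //; split.
    - by move=> z /dD; exact: is_derive_continuous.
    - apply: cvg_at_right_filter; apply: cvgD; apply: cvgM; try exact: cvg_cst.
        by apply: cv; rewrite y0.
      exact: sqrt_continuous.
    - apply: cvgD; apply: cvgM; try exact: cvg_cst.
        by rewrite v1.
      by apply: cvg_at_left_filter; exact: sqrt_continuous.
  have [z + DE] := MVT y1 dD cD; rewrite in_itv/= => /andP[yz z1].
  have z0 : 0 < z by rewrite (lt_trans y0).
  have : D y <= D 1.
    rewrite -subr_ge0 DE mulr_ge0 ?subr_ge0 ?(ltW y1)//.
    have : `|s * (f z / z)| <= c / Num.sqrt z.
      rewrite normrM -[leRHS]mul1r ler_pM// normrM normfV (gtr0_norm z0).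
      rewrite ler_pdivrMr// -[X in _ <= _ * X](sqr_sqrtr (ltW z0)).
      have -> : c / Num.sqrt z * Num.sqrt z ^+ 2 = c * Num.sqrt z.
        by field; rewrite lt0r_neq0 ?s0.
      by apply: fc; rewrite z0 ltW.
    rewrite ler_norml => /andP[+ _].
    have -> : 2 * c * (2 * Num.sqrt z)^-1 = c / Num.sqrt z.
      by field; rewrite lt0r_neq0 ?s0.
    lra.
  rewrite /D v1 sqrtr1 mulr0 add0r mulr1.
  by apply: le_trans; rewrite lerDl !mulr_ge0// sqrtr_ge0.
rewrite ler_norml; apply/andP; split.
  have := H (-1); rewrite normrN1 => /(_ (lexx 1)); lra.
by have := H 1; rewrite normr1 mul1r; apply.
Qed.

(** Functions in the domain of [A] are in the domain of the pointwise operator: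
    their flux [y * v' y] vanishes at [0] and is O(sqrt y), whence [v] is
    bounded. *)
Lemma operA_in_domain v w : operA 0 v w -> exists f, in_domain v f w.
Proof.
move=> [dv [Lv vdv fin v1 [Lf Lw fw]]].
pose f x := x * dv x.
have {}fw x y : 0 < x -> x <= y -> y <= 1 ->
    f y - f x = \int[leb R]_(z in `[x, y]) w z.
  by move=> x0 xy y1; have [_ <-] := fw x y x0 xy y1; rewrite !subr0.
have dvE y : 0 < y -> dv y = f y / y.
  by move=> y0; rewrite /f mulrAC mulfV ?mul1r// lt0r_neq0.
have iw := L2_integrable Lw.
have half y : 0 < y -> 0 < y / 2 < y by move=> y0; apply/andP; split; lra.
have interior (F : R -> R) : (forall e : R, 0 < e -> e < 1 -> {within `[e, 1], continuous F}) ->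
    {in `]0, 1[, continuous F}.
  move=> cF y; rewrite in_itv/= => /andP[y0 y1].
  have /andP[h0 hy] := half _ y0; have h1 := lt_trans hy y1.
  have /(continuous_within_itvP _ h1)[+ _ _] := cF _ h0 h1.
  by apply; rewrite in_itv/= hy.
have wf e : 0 < e -> e < 1 -> {within `[e, 1], continuous f}.
  move=> e0 e1; apply: (within_continuous_pint (w := w) (ltW e1)).
    exact: L2_integrable_cc (ltW e0) Lw.
  by move=> z /andP[ez z1]; rewrite fw.
have wv e : 0 < e -> e < 1 -> {within `[e, 1], continuous v}.
  move=> e0 e1; have [idv _] := vdv _ _ e0 (ltW e1) (lexx 1).
  apply: (within_continuous_pint (ltW e1) idv) => z /andP[ez z1].
  by have [_ ->] := vdv _ _ e0 ez z1.
have cdv y : 0 < y < 1 -> {for y, continuous dv}.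
  move=> /[dup] y01 /andP[y0 y1].
  have h : f z / z @[z --> y] --> f y / y.
    apply: cvgM; last by apply: cvgV; [exact: lt0r_neq0|exact: cvg_id].
    by apply: (interior f wf); rewrite in_itv/= y0.
  apply: (cvg_near h); first by rewrite dvE.
  near=> z; rewrite dvE//; have /andP[hz _] : y / 2 <= z <= 1.
    by near: z; apply: near_cc; case/andP: (half _ y0) => _ ->.
  by apply: lt_le_trans hz; case/andP: (half _ y0).
have dvd y : 0 < y < 1 -> is_derive y 1 v (f y / y).
  move=> /[dup] y01 /andP[y0 y1]; rewrite -dvE//.
  have /andP[h0 hy] := half _ y0; have h1 := lt_trans hy y1.
  have [idv _] := vdv _ _ h0 (ltW h1) (lexx 1).
  have [dp dpE] := continuous_FTC1_closed y1 idv hy (cdv _ y01).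
  have d1 : is_derive y 1 (fun z => v (y / 2) + pint (y / 2) dv z) (0 + dv y).
    apply: is_derive_add; apply: DeriveDef => //; by rewrite -derive1E.
  rewrite add0r in d1; apply: near_eq_is_derive d1.
  near=> z; have /andP[hz z1] : y / 2 <= z <= 1.
    by near: z; apply: near_cc; rewrite hy.
  by rewrite /parameterized_integral; have [_ <-] := vdv _ _ h0 hz z1; rewrite subrKC.
have [h0 h1] : (0 : R) < 2^-1 /\ (2^-1 : R) < 1 by split; lra.
have lv : v y @[y --> 1^'-] --> (0 : R).
  by rewrite -v1; have /(continuous_within_itvP _ h1)[] := wv _ h0 h1.
have fl : f y @[y --> 0^'+] --> f 1 - \int[leb R]_(x in `]0, 1[) w x.
  have h : f 1 - pint e w 1 @[e --> 0^'+] -->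
      f 1 - \int[leb R]_(x in `]0, 1[) w x.
    by apply: cvgB; [exact: cvg_cst|exact: cvg_pint0].
  apply: (cvg_near h) => //; near=> e.
  rewrite /parameterized_integral -fw ?subKr//; near: e.
  exact: nbhs_right_le.
have l0 : f 1 - \int[leb R]_(x in `]0, 1[) w x = 0.
  apply: (flux_limit0 fl); apply/integrableP.
  have EE x : 0 < x < 1 -> (x - 0) * dv x ^+ 2 = f x ^+ 2 / x.
    move=> /andP[x0 _]; rewrite subr0 /f; field.
    exact: lt0r_neq0.
  split.
    apply/measurable_EFinP; apply: (@measurable_funM _ _ _ _ (fun x => f x ^+ 2)).
      apply: measurable_funX; have [+ _] := (L2P 0 _).1 Lf.
      by apply: eq_measurable_fun => x _; rewrite /f subr0.
    apply: open_continuous_measurable_fun; first exact: interval_open.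
    move=> x; rewrite inE/= in_itv/= => /andP[x0 _].
    by apply: cvgV; [exact: lt0r_neq0|exact: cvg_id].
  apply: le_lt_trans fin; rewrite le_eqVlt; apply/orP; left; apply/eqP.
  apply: eq_integral => x; rewrite inE/= in_itv/= => x01; rewrite EE//= ger0_norm//.
  have /andP[x0 _] := x01; by rewrite divr_ge0 ?sqr_ge0 ?ltW.
rewrite l0 in fl.
exists f; split => //.
have fs := flux_sqrt_bound Lw fw fl.
exists (2 * ((1 + ip w w) / 2)); apply: (bounded_of_flux _ v1 dvd lv fs).
by rewrite divr_ge0 ?addr_ge0 ?ip_ge0.
Unshelve. all: by end_near. Qed.

End domain_of_operA.

(** * Affine change of variables *)

Section affine_change_of_variables.
Context {R : realType}.
Variables (a L : R).
Hypothesis L0 : 0 < L.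
Implicit Types (x y : R) (f g : R -> R).

Let aff y := a + L * y.

Lemma measurable_affine : measurable_fun [set: R] aff.
Proof.
apply: continuous_measurable_fun => x; apply: cvgD; first exact: cvg_cst.
by apply: cvgM; [exact: cvg_cst|exact: cvg_id].
Qed.

Let pushforward_affine : {measure set (measurableTypeR R) -> \bar R} :=
  measure_function_pushforward__canonical__measure_function_Measure (leb R)
    (measurable_affine : measurable_fun [set: measurableTypeR R] (aff : measurableTypeR R -> measurableTypeR R)).

Lemma preimage_affine_itv (b0 b1 : bool) x y :
  aff @^-1` [set` Interval (BSide b0 (aff x)) (BSide b1 (aff y))] =
  [set` Interval (BSide b0 x) (BSide b1 y)].
Proof.
apply/seteqP; split => z /=; rewrite !in_itv /= /aff.
  by case: b0; case: b1; rewrite /= ?(lerD2l, ltrD2l) ?(ler_pM2l L0, ltr_pM2l L0).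
by case: b0; case: b1; rewrite /= ?(lerD2l, ltrD2l) ?(ler_pM2l L0, ltr_pM2l L0).
Qed.

(** Lebesgue measure is determined by its values on half-open intervals, and an
    interval is contracted by the factor [L] when it is pulled back. *)
Lemma lebesgue_measure_affine (A : set (measurableTypeR R)) : measurable A ->
  lebesgue_measure A =
  mscale (NngNum (ltW L0)) pushforward_affine A.
Proof.
apply: lebesgue_measure_unique => _ [[x y] _ <-] /=.
rewrite /mscale /= /pushforward /=.
have affK z : aff ((z - a) / L) = z.
  by rewrite /aff mulrC divfK ?lt0r_neq0// subrKC.
rewrite -[in RHS](affK x) -[in RHS](affK y) preimage_affine_itv.
rewrite !lebesgue_measure_itv/= !lte_fin ltr_pdivrMr// divfK ?lt0r_neq0//.
rewrite ltrD2r; case: ifPn => _; last by rewrite mule0.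
rewrite -!EFinB -EFinM; congr EFin; field; exact: lt0r_neq0.
Qed.

Lemma ge0_integral_affine (D : set (measurableTypeR R)) (f : R -> \bar R) : measurable D ->
  measurable_fun D f -> (forall x, D x -> (0 <= f x)%E) ->
  (\int[leb R]_(y in aff @^-1` D) f (aff y) =
   (L^-1)%:E * \int[leb R]_(x in D) f x)%E.
Proof.
move=> mD mf f0.
have -> : (\int[leb R]_(x in D) f x =
    L%:E * \int[leb R]_(y in aff @^-1` D) f (aff y))%E.
  rewrite (eq_measure_integral (mscale (NngNum (ltW L0)) pushforward_affine)).
    rewrite ge0_integral_mscale//= ge0_integral_pushforward//.
      exact: measurable_affine.
    by move=> x; rewrite inE; exact: f0.
  by move=> A mA _; exact: lebesgue_measure_affine.
by rewrite muleA -EFinM mulVf ?lt0r_neq0// mul1e.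
Qed.

Lemma measurable_fun_affine d (T : measurableType d) (D : set (measurableTypeR R))
    (f : measurableTypeR R -> T) : measurable D -> measurable_fun D f ->
  measurable_fun (aff @^-1` D) (fun y => f (aff y)).
Proof.
move=> mD mf; apply: (measurable_comp (F := D)) => //.
  by move=> _ [y Dy <-].
exact: measurable_funTS measurable_affine.
Qed.

Lemma integrable_affine (D : set (measurableTypeR R)) (f : R -> \bar R) : measurable D ->
  (leb R).-integrable D f ->
  (leb R).-integrable (aff @^-1` D) (fun y => f (aff y)).
Proof.
move=> mD /integrableP[mf foo]; apply/integrableP; split.
  exact: measurable_fun_affine.
have := @ge0_integral_affine D (fun x => `|f x|%E) mD.
move=> /= -> //; last exact: measurableT_comp.
by rewrite lte_mul_pinfty// lee_fin invr_ge0 ltW.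
Qed.

Lemma Rintegral_affine (D : set (measurableTypeR R)) f : measurable D ->
  (leb R).-integrable D (EFin \o f) ->
  \int[leb R]_(y in aff @^-1` D) f (aff y) =
  L^-1 * \int[leb R]_(x in D) f x.
Proof.
move=> mD /[dup] fi /integrableP[mf foo].
rewrite /Rintegral integralE [in RHS]integralE.
have mp := measurable_funepos mf; have mn := measurable_funeneg mf.
have := ge0_integral_affine mD mp (fun x _ => funepos_ge0 _ x) => /= hp.
have := ge0_integral_affine mD mn (fun x _ => funeneg_ge0 _ x) => /= hn.
have ip := integrable_fin_num mD (integrable_funepos mD fi).
have im := integrable_fin_num mD (integrable_funeneg mD fi).
rewrite (fineB ip im) mulrBr.
have -> : L^-1 = fine (L^-1)%:E by [].
rewrite -!fineM// -fineB ?fin_numM// -hp -hn.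
congr (fine (_ - _)); apply: eq_integral => y _.
  by rewrite [RHS]funeposE funeposE.
by rewrite [RHS]funenegE funenegE.
Qed.

End affine_change_of_variables.

(** Solutions for [a = 0], with the regularity of the domain made explicit.
    Continuity in time is assumed at [0] only: at positive times it follows from
    differentiability. *)
Record evolution {R : realType} (V : R -> R -> R) : Prop := Evolution {
  evo_L2 : forall t, 0 <= t -> L2 0 (V t) ;
  evo_init : ip (fun x => V t x - V 0 x) (fun x => V t x - V 0 x)
    @[t --> 0^'+] --> (0 : R) ;
  evo_eq : forall t, 0 < t ->
    exists f w, in_domain (V t) f w /\ L2_is_derive t V w }.

Section rescaling.
Context {R : realType}.
Variable a : R.
Hypothesis a1 : a < 1.
Implicit Types (x y t : R) (v w f g : R -> R).

Let L := 1 - a.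
Let aff y := a + L * y.

Let L0 : 0 < L. Proof. by rewrite subr_gt0. Qed.

Let aff0 : aff 0 = a. Proof. by rewrite /aff mulr0 addr0. Qed.

Let aff1 : aff 1 = 1. Proof. by rewrite /aff mulr1 subrKC. Qed.

Let affE : aff @^-1` `]a, 1[ = [set` `]0, 1[].
Proof.
have := @preimage_affine_itv _ a _ L0 false true 0 1.
by rewrite -/(aff 0) -/(aff 1) aff0 aff1.
Qed.

Lemma L2_rescale f : L2 a f -> L2 0 (fun y => f (aff y)).
Proof.
move=> /L2P[mf if2]; apply/L2P; rewrite -affE; split.
  exact: measurable_fun_affine.
exact: (integrable_affine a L0 _ if2).
Qed.

Lemma ip_rescale f : L2 a f -> ip (fun y => f (aff y)) (fun y => f (aff y)) =
  L^-1 * \int[leb R]_(x in `]a, 1[) (f x * f x).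
Proof.
move=> Lf; have iff := L2_mul_integrable Lf Lf.
rewrite -(Rintegral_affine a L0 _ iff)//.
by rewrite /ip -affE.
Qed.

Lemma weak_derivative_rescale f df : weak_derivative a f df ->
  weak_derivative 0 (fun y => f (aff y)) (fun y => L * df (aff y)).
Proof.
move=> fdf x y x0 xy y1.
have [|||idf fE] := fdf (aff x) (aff y).
- by rewrite /aff ltrDl mulr_gt0.
- by rewrite lerD2l ler_pM2l.
- by rewrite -[leRHS]aff1 lerD2l ler_pM2l.
have idfa := integrable_affine a L0 (measurable_itv _) idf.
have := Rintegral_affine a L0 (measurable_itv _) idf.
rewrite (preimage_affine_itv a L0 true false) in idfa *.
move=> E; split; first exact: (integrableZl _ L idfa).
by rewrite RintegralZl// E fE mulrA mulfV ?mul1r// lt0r_neq0.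
Qed.

Lemma operA_rescale v w : operA a v w ->
  operA 0 (fun y => v (aff y)) (fun y => L * w (aff y)).
Proof.
move=> [dv [Lv vdv fin v1 [Lf Lw fw]]].
exists (fun y => L * dv (aff y)).
have fE : (fun x => (x - 0) * (L * dv (aff x))) =
    (fun y => (aff y - a) * dv (aff y)).
  by apply/funext => x; rewrite /aff; ring.
split.
- exact: L2_rescale.
- exact: weak_derivative_rescale.
- pose E x := ((x - a) * dv x ^+ 2)%:E.
  have E0 x : `]a, 1[%classic x -> (0 <= E x)%E.
    rewrite /= in_itv/= => /andP[ax _].
    by rewrite lee_fin mulr_ge0 ?sqr_ge0// subr_ge0 ltW.
  have mE : measurable_fun `]a, 1[ E.
    apply/measurable_EFinP.
    apply: (@eq_measurable_fun _ _ _ _ _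
        (fun x => ((x - a) * dv x) ^+ 2 / (x - a))).
      move=> x; rewrite inE/= in_itv/= => /andP[ax _]; field.
      by rewrite subr_eq0 gt_eqF.
    apply: measurable_funM.
      by apply: measurable_funX; have [+ _] := (L2P a _).1 Lf.
    apply: open_continuous_measurable_fun; first exact: interval_open.
    move=> x; rewrite inE/= in_itv/= => /andP[ax _].
    apply: cvgV; first by rewrite subr_eq0 gt_eqF.
    by apply: cvgB; [exact: cvg_id|exact: cvg_cst].
  have := ge0_integral_affine a L0 (measurable_itv _) mE E0.
  rewrite affE => EE.
  have -> : (\int[leb R]_(x in `]0%R, 1%R[)
      ((x - 0) * (L * dv (aff x)) ^+ 2)%:E = L%:E *
      \int[leb R]_(x in `]0%R, 1%R[) E (aff x))%E.
    rewrite -ge0_integralZl//.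
    - apply: eq_integral => x _; rewrite /E -EFinM /aff; congr EFin; ring.
    - by rewrite -affE; exact: measurable_fun_affine.
    - by move=> x; rewrite -affE => x01; exact: E0.
    - by rewrite lee_fin ltW.
  rewrite EE muleA -EFinM mulfV ?lt0r_neq0// mul1e; exact: fin.
- by rewrite aff1.
- split.
  + by rewrite fE; exact: (L2_rescale Lf).
  + exact: L2Z (L2_rescale Lw).
  + by rewrite fE; exact: (weak_derivative_rescale fw).
Qed.

(** The solution on [(a, 1)], transported to [(0, 1)] with time slowed down by
    the factor [1 - a], is an evolution for the operator with [a = 0]. *)
Lemma evolution_rescale u0 u : solution a u0 u ->
  evolution (fun t y => u (aff y) (L * t)).
Proof.
move=> [_ Lu cu du]; split.
- move=> t t0; have Lt : 0 <= L * t by rewrite mulr_ge0// ltW.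
  exact: (L2_rescale (Lu _ Lt)).
- have cL : L * t @[t --> (0 : R)^'+] --> within `[0, +oo[ (nbhs (0 : R)).
    move=> P [/= e e0 Pe]; exists (e / L); first by rewrite /= divr_gt0.
    move=> t /=; rewrite sub0r normrN => te t0; apply: Pe => /=.
      by rewrite sub0r normrN normrM (gtr0_norm L0) mulrC -ltr_pdivlMr.
    by rewrite in_itv/= andbT mulr_ge0// ltW.
  have := cvg_comp _ _ cL (cu 0 (lexx 0)) => cu0.
  have Lt : \forall t \near (0 : R)^'+, L2 a (fun x => u x (L * t) - u x 0).
    near=> t; have t0 : 0 <= L * t by rewrite mulr_ge0// ltW.
    by apply: L2B; exact: Lu.
  have h : \int[leb R]_(x in `]a, 1[) ((u x (L * t) - u x 0) *
      (u x (L * t) - u x 0)) @[t --> (0 : R)^'+] --> (0 : R).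
    exact: L2norm_cvg0 Lt cu0.
  apply: (cvg_near (cvgM (cvg_cst L^-1) h)); first by rewrite mulr0.
  apply: filterS Lt => t Lt; rewrite mulr0.
  by rewrite (ip_rescale (f := fun x => u x (L * t) - u x 0)).
- move=> t t0; have Lt0 : 0 < L * t by rewrite mulr_gt0.
  have [w [Aw dw]] := du _ Lt0.
  have [f domf] := operA_in_domain (operA_rescale Aw).
  exists f, (fun y => L * w (aff y)); split => //.
  have [dv [_ _ _ _ [_ Lw _]]] := Aw.
  have Ln : \forall s \near (L * t), L2 a (u^~ s).
    have : \forall s \near (L * t), 0 <= s <= L * t + 1.
      by apply: near_cc; rewrite Lt0 ltrDl ltr01.
    by apply: filterS => s /andP[s0 _]; exact: Lu.
  have Uw : L2_is_derive (L * t + 0) (fun s y => u (aff y) s)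
      (fun y => w (aff y)).
    rewrite addr0; split.
    - by apply: filterS Ln => s; exact: L2_rescale.
    - exact: L2_rescale.
    - have Lnh := near_shift0 Ln.
      have Lq : \forall h \near (0 : R)^', L2 a (fun x =>
          h^-1 * (u x (L * t + h) - u x (L * t)) - w x).
        apply: filterS Lnh => h Lh; apply: L2B => //; apply: L2Z.
        by apply: L2B => //; apply: Lu; exact: ltW.
      have h : \int[leb R]_(x in `]a, 1[) (
          (h^-1 * (u x (L * t + h) - u x (L * t)) - w x) *
          (h^-1 * (u x (L * t + h) - u x (L * t)) - w x))
          @[h --> (0 : R)^'] --> (0 : R).
        exact: L2norm_cvg0 Lq dw.
      apply: (cvg_near (cvgM (cvg_cst L^-1) h)); first by rewrite mulr0.
      apply: filterS Lq => k Lk.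
      by rewrite (ip_rescale (f := fun x =>
        k^-1 * (u x (L * t + k) - u x (L * t)) - w x)).
  have := L2_derive_affine (lt0r_neq0 L0) Uw.
  by rewrite (_ : (fun s => _) = fun s y => u (aff y) (L * s))//;
    apply/funext => s; rewrite addr0.
Unshelve. all: by end_near. Qed.

(** At a positive time the solution has a genuine left derivative at [1], so the
    limit that defines the boundary flux is the rescaled flux at [1]. *)
Lemma boundary_flux_rescale (u : R -> R -> R -> R) f w t :
  in_domain (fun y => u a (aff y) (L * t)) f w ->
  boundary_flux u a (L * t) = L^-1 * f 1.
Proof.
move=> dom; apply/cvg_lim => //.
have cL : L^-1 * h @[h --> (0 : R)^'-] --> (0 : R)^'-.
  move=> P [/= e e0 Pe]; exists (e * L); first by rewrite /= mulr_gt0.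
  move=> k /=; rewrite sub0r normrN => ke k0; apply: Pe => /=.
    rewrite sub0r normrN normrM gtr0_norm ?invr_gt0// mulrC.
    by rewrite ltr_pdivrMr.
  by rewrite pmulr_rlt0 ?invr_gt0.
have h := cvg_comp _ _ cL (dom_left_derivative dom).
apply: (cvg_near (cvgM (cvg_cst L^-1) h)) => //; near=> k.
have kN : k != 0 by rewrite lt_eqF//; near: k; exact: nbhs_left_lt.
rewrite /= aff1 (_ : aff (1 + L^-1 * k) = 1 + k).
  by field; rewrite kN lt0r_neq0.
by rewrite /aff mulrDr mulrA mulfV ?lt0r_neq0// /L; ring.
Unshelve. all: by end_near. Qed.

End rescaling.

(** * Mass and flux of an evolution *)

Section evolution_theory.
Context {R : realType}.
Implicit Types (c s t tau : R) (U V : R -> R -> R) (f w phi : R -> R).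

Lemma L2_continuous (g : R -> R) : continuous g -> L2 0 g.
Proof.
move=> cg; apply/L2P; split.
  by apply: measurable_funTS; exact: continuous_measurable_fun.
have : (leb R).-integrable `[0, 1] (EFin \o (fun x => g x ^+ 2)).
  apply: continuous_compact_integrable; first exact: segment_compact.
  apply: continuous_subspaceT => x; rewrite /continuous_at.
  under eq_fun do rewrite expr2; rewrite expr2.
  by apply: cvgM; exact: cg.
by apply: integrableS => //; exact: subset_itv_oo_cc.
Qed.

(** Functions that are smooth up to the degenerate end [0]. *)
Lemma in_domain_smooth (v dv w : R -> R) :
  (forall y : R, is_derive y 1 v (dv y)) ->
  (forall y : R, is_derive y 1 (fun y : R => y * dv y) (w y)) ->
  continuous w -> v 1 = 0 ->
  in_domain v (fun y => y * dv y) w.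
Proof.
move=> dvE df cw v1.
have cv : continuous v by move=> y; exact: (is_derive_continuous (dvE y)).
have cf (y : R) : {for y, continuous (fun y : R => y * dv y)}.
  exact: (is_derive_continuous (df y)).
split => //.
- exact: L2_continuous.
- exact: L2_continuous.
- by rewrite -v1; apply: cvg_at_left_filter; exact: cv.
- move=> y /andP[y0 _]; rewrite mulrAC mulfV ?mul1r ?lt0r_neq0//.
- move=> x y x0; rewrite le_eqVlt => /predU1P[->|xy] y1.
    by rewrite subrr set_itv1 Rintegral_set1.
  rewrite /Rintegral (@continuous_FTC2 _ w (fun y => y * dv y))//.
  + exact: continuous_subspaceT.
  + split => //.
    * exact/cvg_at_right_filter/cf.
    * exact/cvg_at_left_filter/cf.
  + by move=> z _; rewrite derive1E; have := df z => d; rewrite derive_val.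
- rewrite -[X in _ --> X](mul0r (dv 0)); apply: cvg_at_right_filter; exact: cf.
- have /compact_bounded[M [_ Mv]] :=
    continuous_compact (continuous_subspaceT cv) (@segment_compact R 0 1).
  exists (M + 1) => y /andP[y0 y1]; apply: (Mv (M + 1)); first by rewrite ltrDl.
  by exists y => //=; rewrite in_itv/= !ltW.
Qed.

Lemma L2_derive_scalar t (g : R -> R) dg phi : is_derive t 1 g dg ->
  L2 0 phi -> L2_is_derive t (fun s x => g s * phi x) (fun x => dg * phi x).
Proof.
move=> dgt Lphi; split.
- by apply: filterE => s; exact: L2Z.
- exact: L2Z.
have q := (is_deriveP g t dg).1 dgt.
have h : (h^-1 * (g (t + h) - g t) - dg) * (h^-1 * (g (t + h) - g t) - dg) *
    ip phi phi @[h --> (0 : R)^'] --> (dg - dg) * (dg - dg) * ip phi phi.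
  apply: cvgM; last exact: cvg_cst.
  by apply: cvgM; apply: cvgB => //; exact: cvg_cst.
apply: (cvg_near h); first by rewrite subrr !mul0r.
apply: nearW => k.
rewrite [RHS](@eq_ip _ _ (fun x => (k^-1 * (g (t + k) - g t) - dg) * phi x) _
  (fun x => (k^-1 * (g (t + k) - g t) - dg) * phi x)).
- by rewrite ipZl ?ipZr ?mulrA//; exact: L2Z.
- by move=> x _; ring.
- by move=> x _; ring.
Qed.

Lemma L2_derive_cst t phi : L2 0 phi ->
  L2_is_derive t (fun _ x => phi x) (fun=> 0).
Proof.
move=> Lphi; split; [exact: filterE|exact: L2_cst|].
have h0 : forall x h : R, h^-1 * (phi x - phi x) - 0 = 0 by move=> x h; ring.
apply: (cvg_near (cvg_cst (0 : R))) => //; apply: nearW => h.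
by rewrite (@eq_ip _ _ (fun=> 0) _ (fun=> 0)) ?ip0l// => x _; rewrite h0.
Qed.

Section pairing.
Variables (U V : R -> R -> R) (tau : R).
Hypotheses (tau0 : 0 < tau) (eU : evolution U) (eV : evolution V).

Lemma pairing_cvg0 :
  ip (U t) (V (tau - t)) @[t --> 0^'+] --> ip (U 0) (V tau).
Proof.
have [f [w [_ dV]]] := evo_eq eV tau0.
have n0 : - t @[t --> (0 : R)^'+] --> (0 : R)^'.
  move=> P [/= e e0 Pe]; exists e => // t /=; rewrite sub0r normrN => te t0.
  by apply: Pe => /=; rewrite ?sub0r ?normrN// oppr_eq0 gt_eqF.
have cV := cvg_comp _ _ n0 (L2_derive_continuous dV).
have LV : \forall t \near (0 : R)^'+, L2 0 (V (tau - t)).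
  near=> t; apply: (evo_L2 eV); rewrite subr_ge0; near: t.
  exact: nbhs_right_le.
have LU : \forall t \near (0 : R)^'+, L2 0 (U t).
  by near=> t; apply: (evo_L2 eU).
apply: ip_cvg => //; [exact: (evo_L2 eU)|exact: (evo_L2 eV (ltW tau0))|].
exact: (evo_init eU).
Unshelve. all: by end_near. Qed.

(** The two contributions of the operator cancel by symmetry. *)
Lemma pairing_derive s : 0 < s < tau ->
  is_derive s 1 (fun s => ip (U s) (V (tau - s))) 0.
Proof.
move=> /andP[s0 st].
have [f1 [w1 [dom1 d1]]] := evo_eq eU s0.
have ts : 0 < tau - s by rewrite subr_gt0.
have [f2 [w2 [dom2 d2]]] := evo_eq eV ts.
have N1 : (-1 : R) != 0 by rewrite oppr_eq0 oner_eq0.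
rewrite (_ : tau - s = -1 * s + tau) in d2; last by ring.
have d3 := L2_derive_affine N1 d2.
have d := is_derive_ip d1 d3.
rewrite (_ : (fun s => ip (U s) (V (-1 * s + tau))) =
  (fun s => ip (U s) (V (tau - s)))) in d; last first.
  by apply/funext => r; congr (ip _ (V _)); ring.
apply: (is_derive_eq d).
rewrite (_ : -1 * s + tau = tau - s); last by ring.
rewrite ipZr; [|exact: dom_L2A dom2|exact: dom_L2 dom1].
by rewrite (dom_symmetric dom1 dom2); ring.
Qed.

End pairing.

(** Self-adjointness of the semigroup: pairing one evolution with another one
    run backwards in time gives a constant. *)
Lemma pairing_cst U V tau s : 0 < tau -> evolution U -> evolution V ->
  0 <= s <= tau -> ip (U s) (V (tau - s)) = ip (U 0) (V tau).
Proof.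
move=> tau0 eU eV /andP[s0 st].
pose F s := ip (U s) (V (tau - s)).
have FD x : x \in `]0, tau[ -> is_derive x 1 F 0.
  by rewrite in_itv/= => x01; exact: pairing_derive.
have cF : {within `[0, tau], continuous F}.
  apply/continuous_within_itvP => //; split.
  - by move=> x /FD; exact: is_derive_continuous.
  - by rewrite {2}/F subr0; exact: pairing_cvg0.
  - have n0 : tau - t @[t --> tau^'-] --> (0 : R)^'+.
      move=> P [/= e e0 Pe]; exists e => // t /= te t0.
      by apply: Pe => /=; rewrite ?sub0r ?normrN// subr_gt0.
    have := cvg_comp _ _ n0 (pairing_cvg0 tau0 eV eU).
    rewrite /F subrr (ipC (U tau)) => h; apply: (cvg_near h) => //.
    by apply: nearW => t /=; rewrite subKr ipC.
have cFs : {within `[0, s], continuous F}.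
  by apply: continuous_subspaceW cF; apply: subset_itvl; rewrite bnd_simp.
have FDs x : x \in `]0, s[ -> is_derive x 1 F 0.
  rewrite in_itv/= => /andP[x0 xs]; apply: FD.
  by rewrite in_itv/= x0 (lt_le_trans xs).
have [x _] := MVT_segment s0 FDs cFs.
by rewrite mul0r /F subr0 => /eqP; rewrite subr_eq0 => /eqP.
Qed.

Definition mass V t := ip (V t) (fun=> 1).

Lemma mass_derive V t w : L2_is_derive t V w ->
  is_derive t 1 (mass V) (ip w (fun=> 1)).
Proof.
move=> dV; have L1 := @L2_cst R 1.
have d := is_derive_ip dV (L2_derive_cst t L1).
by apply: (is_derive_eq d); rewrite (ipC (V t)) ip0l addr0.
Qed.

Section mass_of_unit_evolution.
Variables (V : R -> R -> R).
Hypotheses (eV : evolution V) (V0 : forall x, 0 < x < 1 -> V 0 x = 1).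

(** [<V(s + t), 1> = <V(s + t), V(0)> = <V(s), V(t)>]; in particular the mass is a
    squared norm at half the time. *)
Lemma mass_split s t : 0 <= s -> 0 <= t -> 0 < s + t ->
  mass V (s + t) = ip (V s) (V t).
Proof.
move=> s0 t0 st0.
have -> : t = s + t - s by ring.
rewrite pairing_cst//; last by rewrite s0 lerDl.
rewrite /mass ipC addrC subrK; apply: eq_ip => // x x01; by rewrite V0.
Qed.

Lemma mass_ge0 t : 0 < t -> 0 <= mass V t.
Proof.
move=> t0; have h0 : 0 <= t / 2 by rewrite divr_ge0// ltW.
by rewrite [in leRHS](splitr t) mass_split// ?ip_ge0// -splitr.
Qed.

(** Splitting the time moves the derivative to one factor only, so that the mass
    can be differentiated a second time without differentiating [V] twice. *)
Lemma mass_derive_split s t w : 0 < s -> 0 < t -> L2_is_derive s V w ->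
  is_derive (s + t) 1 (mass V) (ip w (V t)).
Proof.
move=> s0 t0 dV.
have d1 : L2_is_derive (1 * (s + t) + - t) V w by rewrite mul1r addrK.
have d2 := L2_derive_affine (oner_neq0 _) d1.
have LVt := evo_L2 eV (ltW t0).
have d3 := is_derive_ip d2 (L2_derive_cst (s + t) LVt).
have d4 : is_derive (s + t) 1 (fun r => ip (V (1 * r + - t)) (V t)) (ip w (V t)).
  apply: (is_derive_eq d3); rewrite (ipC _ (fun=> 0)) ip0l addr0.
  by apply: eq_ip => // x _; rewrite mul1r.
apply: near_eq_is_derive d4.
have : \forall r \near (s + t), t <= r <= s + t + 1.
  by apply: near_cc; rewrite ltrDr s0 ltrDl ltr01.
apply: filterS => r /andP[tr _]; rewrite mul1r -mass_split ?subr_ge0 ?(ltW t0)//.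
  by rewrite subrK.
by rewrite subrK (lt_le_trans t0).
Qed.

(** With [B] the operator, the mass [m] satisfies [m = <V, V>],
    [m' = <B V, V>] and [m'' = <B V, B V>] at half the time. The Poincare
    inequality is [m <= - m'], and with [0 <= |B V + V| ^ 2 = m'' + 2 m' + m] it
    gives [- m' <= m'']. *)
Lemma mass_convex t : 0 < t -> exists m2,
  [/\ is_derive t 1 (mass V) (derive1 (mass V) t),
      is_derive t 1 (derive1 (mass V)) m2,
      mass V t <= - derive1 (mass V) t &
      - derive1 (mass V) t <= m2].
Proof.
move=> t0; pose s := t / 2.
have s0 : 0 < s by rewrite divr_gt0.
have tE : s + s = t by rewrite /s -splitr.
have [f [w [dom dV]]] := evo_eq eV s0.
have mE r : 0 < r -> derive1 (mass V) (r + s) = ip (V r) w.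
  move=> r0; have [g [z [domr dVr]]] := evo_eq eV r0.
  rewrite derive1E; have := mass_derive_split r0 s0 dVr => d.
  by rewrite derive_val; exact: (dom_symmetric domr dom).
have dm : is_derive t 1 (mass V) (derive1 (mass V) t).
  have [g [z [domt dVt]]] := evo_eq eV t0.
  rewrite derive1E; apply: derivableP.
  by have := mass_derive dVt => d; exact: ex_derive.
have m1E : derive1 (mass V) t = ip w (V s) by rewrite -tE mE// ipC.
have m0E : mass V t = ip (V s) (V s).
  by rewrite -tE mass_split ?(ltW s0)// addr_gt0.
have P := dom_poincare dom.
have [Lw LV] := (dom_L2A dom, dom_L2 dom).
exists (ip w w); split => //; last 2 first.
- by rewrite m0E m1E.
- have := ip_ge0 (fun x => w x + V s x).
  rewrite ipDl ?ipDr//; try exact: L2D.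
  rewrite m1E (ipC (V s) w) => h; move: P h.
  set A := ip w (V s); set B := ip w w; set C := ip (V s) (V s); lra.
have d1 : L2_is_derive (1 * t + - s) V w by rewrite mul1r -tE addrK.
have d2 := L2_derive_affine (oner_neq0 _) d1.
have d3 := is_derive_ip d2 (L2_derive_cst t Lw).
have d4 : is_derive t 1 (fun r => ip (V (1 * r + - s)) w) (ip w w).
  apply: (is_derive_eq d3); rewrite (ipC _ (fun=> 0)) ip0l addr0.
  by apply: eq_ip => // x _; rewrite mul1r.
apply: near_eq_is_derive d4.
have : \forall r \near t, t - s / 2 <= r <= t + 1.
  by apply: near_cc; rewrite ltrBlDr ltrDl divr_gt0// ltrDl ltr01.
apply: filterS => r /andP[tr _]; rewrite mul1r -mE ?subrK//.
by rewrite subr_gt0 (lt_le_trans _ tr)//; rewrite /s; lra.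
Qed.

(** For an eigenfunction [phi] the curve [e^(- z t) phi] is an evolution; pairing
    it with [V] at half the time and applying Cauchy-Schwarz bounds the mass from
    below by [e^(- z t)], up to a constant factor. *)
Lemma mass_ge phi f z t : in_domain phi f (fun y => - z * phi y) -> 0 < t ->
  ip (fun=> 1) phi ^+ 2 * expR (- z * t) <= ip phi phi * mass V t.
Proof.
move=> dom t0; have Lphi := dom_L2 dom.
pose U s x := expR (- z * s) * phi x.
have dE s : is_derive s 1 (fun s => expR (- z * s)) (- z * expR (- z * s)).
  have d := is_derive_scale (is_derive_id s 1) (- z).
  apply: (is_derive_eq (is_derive1_comp (is_derive_expR _) d)).
  by rewrite mulr1 mulrC.
have eU : evolution U.
  split.
  - by move=> s _; exact: L2Z.
  - have cE : expR (- z * s) @[s --> (0 : R)^'+] --> expR (- z * 0).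
      apply: cvg_at_right_filter; have d := dE 0.
      exact: (is_derive_continuous d).
    have h : (expR (- z * s) - expR (- z * 0)) *
        (expR (- z * s) - expR (- z * 0)) * ip phi phi
        @[s --> (0 : R)^'+] -->
        (expR (- z * 0) - expR (- z * 0)) * (expR (- z * 0) - expR (- z * 0)) *
        ip phi phi.
      apply: cvgM; last exact: cvg_cst.
      by apply: cvgM; apply: cvgB => //; exact: cvg_cst.
    apply: (cvg_near h); first by rewrite subrr !mul0r.
    apply: filterE => s.
    rewrite [RHS](@eq_ip _ _ (fun x => (expR (- z * s) - expR (- z * 0)) * phi x)
      _ (fun x => (expR (- z * s) - expR (- z * 0)) * phi x)).
    + by rewrite ipZl ?ipZr ?mulrA//; exact: L2Z.
    + by move=> x _; rewrite /U; ring.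
    + by move=> x _; rewrite /U; ring.
  - move=> s s0.
    (* the zero term matches the shape of [in_domain_lin] *)
    exists (fun y => expR (- z * s) * f y + 0 * f y).
    exists (fun x => - z * expR (- z * s) * phi x); split; last first.
      by apply: L2_derive_scalar.
    have := in_domain_lin (expR (- z * s)) 0 dom dom.
    congr in_domain; apply/funext => y; rewrite /U; ring.
have s0 : 0 < t / 2 by rewrite divr_gt0.
have h : ip (V (t / 2)) phi = expR (- z * (t / 2)) * ip (fun=> 1) phi.
  have := pairing_cst s0 eV eU (s := t / 2).
  rewrite lexx (ltW s0) subrr => /(_ isT).
  rewrite (@eq_ip _ (V (t / 2)) (V (t / 2)) (U 0) phi) => [->||] //.
    rewrite /U ipZr; [|by []|exact: (evo_L2 eV)].
    by congr (_ * _); apply: eq_ip => // x x01; rewrite V0.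
  by move=> x _; rewrite /U mulr0 expR0 mul1r.
have CS := ip_CS (evo_L2 eV (ltW s0)) Lphi.
have E2 : expR (- z * (t / 2)) ^+ 2 = expR (- z * t).
  by rewrite -expRM_natl; congr expR; field.
rewrite h exprMn E2 in CS.
have mE : mass V t = ip (V (t / 2)) (V (t / 2)).
  by rewrite [in LHS](splitr t) mass_split ?(ltW s0)// -splitr.
by rewrite mE mulrC (mulrC (ip phi phi)).
Qed.

(** The flux is the derivative of the mass of [U]. That mass is paired back to
    the initial value, [<U(t), V(0)> = <U(0), V(t)> = m(t) - c <1 - y, V(t)>], and
    the last pairing has derivative [- m] because the operator maps [1 - y], which
    is in its domain, to [- 1]. *)
Lemma evolution_flux U c t f w : evolution U ->
  (forall x, 0 < x < 1 -> U 0 x = 1 - c * (1 - x)) -> 0 < t ->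
  in_domain (U t) f w -> L2_is_derive t U w ->
  f 1 = derive1 (mass V) t + c * mass V t.
Proof.
move=> eU U0 t0 dom dU; rewrite (dom_fluxE dom).
pose psi (y : R) := 1 - y.
have dpsi : in_domain psi (fun y => y * (-1)) (fun=> -1).
  apply: in_domain_smooth.
  - move=> y; have d := is_derive_sub (is_derive_cst (1 : R) y 1) (is_derive_id y 1).
    by apply: (is_derive_eq d); rewrite sub0r.
  - move=> y; have d := is_derive_mul (is_derive_id y 1) (is_derive_cst (-1 : R) y 1).
    by apply: (is_derive_eq d); rewrite /=; ring.
  - by move=> y; exact: cvg_cst.
  - by rewrite /psi subrr.
have Lpsi := dom_L2 dpsi.
have [g [z [domV dV]]] := evo_eq eV t0.
have LV r : 0 < r -> L2 0 (V r) by move=> r0; exact: (evo_L2 eV (ltW r0)).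
have massE r : 0 < r -> mass U r = mass V r - c * ip (V r) psi.
  move=> r0; have := pairing_cst r0 eU eV (s := r).
  rewrite lexx (ltW r0) subrr => /(_ isT) h.
  rewrite /mass -(@eq_ip _ (U r) (U r) (V 0) (fun=> 1))// h.
  rewrite (@eq_ip _ (U 0) (fun x => 1 - c * psi x) (V r) (V r))//.
  have Lc : L2 0 (fun x => c * psi x) by exact: L2Z.
  have [LVr L1] := (LV r r0, @L2_cst R 1).
  rewrite (ipBl L1 Lc LVr) (ipZl c Lpsi LVr).
  by rewrite (ipC psi) (ipC (fun=> 1)).
have d1 := mass_derive dU.
have dn := is_derive_ip dV (L2_derive_cst t Lpsi).
have d2 := is_derive_sub (mass_derive dV) (is_derive_scale dn c).
have d3 : is_derive t 1 (mass U)
    (ip z (fun=> 1) - c * (ip z psi + ip (V t) (fun=> 0))).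
  apply: near_eq_is_derive d2.
  have : \forall r \near t, t / 2 <= r <= t + 1.
    by apply: near_cc; apply/andP; split; lra.
  apply: filterS => r /andP[r1 _]; rewrite massE//.
  by apply: lt_le_trans r1; rewrite divr_gt0.
have [_ <-] := d1; have [_ ->] := d3.
rewrite (ipC (V t)) ip0l addr0 (dom_symmetric domV dpsi).
have -> : ip (V t) (fun=> -1) = - mass V t.
  rewrite /mass -[RHS]mulN1r -ipZr; [|exact: L2_cst|exact: LV].
  by apply: eq_ip => // x _; rewrite mulr1.
by rewrite derive1E; have [_ ->] := mass_derive dV; ring.
Qed.

End mass_of_unit_evolution.
End evolution_theory.

(** * The first Bessel eigenfunction *)

Section bessel.
Context {R : realType}.
Implicit Types (x y z K : R).

(** [J_0 x = bessel0 (x ^ 2 / 4)]; the function [bessel0] is the solution of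
    [(y g')' = - g] that is regular at the origin. *)
Definition bessel0_coeff (k : nat) : R := (-1) ^+ k / (k`! * k`!)%N%:R.

Definition bessel0 (y : R) : R := limn (pseries bessel0_coeff y).

Let dbessel0 (y : R) : R := limn (pseries (pseries_diffs bessel0_coeff) y).

Lemma besselJ0E x : besselJ 0 x = bessel0 ((x / 2) ^+ 2).
Proof.
rewrite /besselJ /bessel0; congr (limn _); congr (series _).
by apply/funext => k; rewrite !addn0 exprM.
Qed.

Lemma is_cvg_pseries_fact (g : nat -> R) K :
  (forall k, `|g k| <= (k`!%:R)^-1) -> cvgn (pseries g K).
Proof.
move=> gk; apply: normed_cvg.
apply: (series_le_cvg _ _ _ (is_cvg_series_exp_coeff `|K|)).
- by move=> n /=.
- by move=> n; exact: exp_coeff_ge0.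
- move=> n /=; rewrite normrM normrX /exp_coeff/= mulrC.
  by rewrite ler_wpM2l ?exprn_ge0.
Qed.

Lemma normr_sign_fact k (n : nat) : (0 < n)%N ->
  `|(-1) ^+ k / (k`! * n)%N%:R| <= (k`!%:R)^-1 :> R.
Proof.
move=> n0; rewrite normrM normrX normrN1 expr1n mul1r ger0_norm ?invr_ge0//.
by rewrite lef_pV2 ?posrE ?ltr0n ?muln_gt0 ?fact_gt0// ler_nat leq_pmulr.
Qed.

Lemma bessel0_coeff_le k : `|bessel0_coeff k| <= (k`!%:R)^-1.
Proof. by rewrite normr_sign_fact ?fact_gt0. Qed.

Lemma diffs_bessel0_coeff k :
  pseries_diffs bessel0_coeff k = - ((-1) ^+ k / (k`! * k.+1`!)%N%:R).
Proof.
rewrite /pseries_diffs /bessel0_coeff exprS factS !natrM.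
have k0 : k`!%:R != 0 :> R by rewrite pnatr_eq0 -lt0n fact_gt0.
have k1 : k.+1%:R != 0 :> R by rewrite pnatr_eq0.
move: k0 k1; move: (k`!%:R) (k.+1%:R) ((-1) ^+ k) => a b e a0 b0.
by field; rewrite a0 b0.
Qed.

Lemma diffs_diffs_bessel0_coeff k :
  pseries_diffs (pseries_diffs bessel0_coeff) k =
  (-1) ^+ k / (k`! * k.+2`!)%N%:R.
Proof.
rewrite {1}/pseries_diffs diffs_bessel0_coeff exprS factS !natrM.
have k0 : k`!%:R != 0 :> R by rewrite pnatr_eq0 -lt0n fact_gt0.
have k2 : k.+2%:R != 0 :> R by rewrite pnatr_eq0.
have k1 : k.+1%:R != 0 :> R by rewrite pnatr_eq0.
move: k0 k1 k2; move: (k`!%:R) (k.+1%:R) (k.+2%:R) ((-1) ^+ k) => a b c e.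
by move=> a0 b0 c0; field; rewrite a0 b0 c0.
Qed.

(** Coefficients of [y g' y]. *)
Let euler_coeff k : R := k%:R * bessel0_coeff k.

Lemma diffs_euler_coeff : pseries_diffs euler_coeff = - bessel0_coeff.
Proof.
apply/funext => k; rewrite /pseries_diffs /euler_coeff /bessel0_coeff.
rewrite [in RHS]/GRing.opp/= exprS factS !natrM.
have k0 : k`!%:R != 0 :> R by rewrite pnatr_eq0 -lt0n fact_gt0.
have k1 : k.+1%:R != 0 :> R by rewrite pnatr_eq0.
move: k0 k1; move: (k`!%:R) (k.+1%:R) ((-1) ^+ k) => a b e a0 b0.
by field; rewrite a0 b0.
Qed.

Lemma cvg_bessel0 K : cvgn (pseries bessel0_coeff K).
Proof. exact/is_cvg_pseries_fact/bessel0_coeff_le. Qed.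

Lemma cvg_dbessel0 K : cvgn (pseries (pseries_diffs bessel0_coeff) K).
Proof.
apply: is_cvg_pseries_fact => k.
by rewrite diffs_bessel0_coeff normrN normr_sign_fact ?fact_gt0.
Qed.

Lemma is_derive_bessel0 y : is_derive y 1 bessel0 (dbessel0 y).
Proof.
apply: (@pseries_snd_diffs _ bessel0_coeff (`|y| + 1)).
- exact: cvg_bessel0.
- exact: cvg_dbessel0.
- apply: is_cvg_pseries_fact => k.
  by rewrite diffs_diffs_bessel0_coeff normr_sign_fact ?fact_gt0.
- by rewrite [ltRHS]ger0_norm ?addr_ge0// ltrDl.
Qed.

(** [y g' y] is itself a power series, whose termwise derivative is [- g]. *)
Lemma cvg_euler_bessel0 y :
  pseries euler_coeff y n @[n --> \oo] --> y * dbessel0 y.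
Proof.
have h := pseries_diffs_equiv (@cvg_dbessel0 y).
apply: cvg_trans (cvgM (cvg_cst y) h); apply: near_eq_cvg.
apply: nearW => n; rewrite /pseries /series/= mulr_sumr.
apply: eq_bigr => -[|i] _; first by rewrite /euler_coeff !mul0r mulr0.
by rewrite /euler_coeff /= exprS; ring.
Qed.

Lemma is_derive_euler_bessel0 y :
  is_derive y 1 (fun y => y * dbessel0 y) (- bessel0 y).
Proof.
have -> : (fun y => y * dbessel0 y) = (fun y => limn (pseries euler_coeff y)).
  by apply/funext => x; apply/esym/cvg_lim => //; exact: cvg_euler_bessel0.
have neg g x : pseries (- g) x = - pseries g x :> (nat -> R).
  apply/funext => n; rewrite [RHS](_ : _ = - (pseries g x n))//.
  rewrite /pseries /series/= -sumrN.
  by apply: eq_bigr => i _; rewrite -mulNr.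
have cN g K : cvgn (pseries g K) -> cvgn (pseries (- g) K).
  by move=> cg; rewrite neg; exact: is_cvgN.
have -> : - bessel0 y = limn (pseries (pseries_diffs euler_coeff) y).
  by rewrite diffs_euler_coeff neg limN//; exact: cvg_bessel0.
apply: (@pseries_snd_diffs _ euler_coeff (`|y| + 1)).
- by apply/cvg_ex; eexists; exact: cvg_euler_bessel0.
- by rewrite diffs_euler_coeff; apply: cN; exact: cvg_bessel0.
- by rewrite diffs_euler_coeff pseries_diffsN; apply: cN; exact: cvg_dbessel0.
- by rewrite [ltRHS]ger0_norm ?addr_ge0// ltrDl.
Qed.

(** At a zero [z] of [bessel0] the dilated function vanishes at [1], and the
    equation [(y g')' = - g] turns into the eigenvalue equation for [- z]. *)
Lemma bessel0_eigenfunction z : bessel0 z = 0 ->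
  in_domain (fun y => bessel0 (z * y)) (fun y => y * (z * dbessel0 (z * y)))
    (fun y => - z * bessel0 (z * y)).
Proof.
move=> z0.
have dz y : is_derive y 1 (fun y => z * y) z.
  have d := is_derive_scale (is_derive_id y 1) z.
  by apply: (is_derive_eq d); rewrite mulr1.
have cb (y : R) : {for y, continuous bessel0}.
  exact: (is_derive_continuous (is_derive_bessel0 y)).
apply: in_domain_smooth.
- move=> y; have := is_derive1_comp (is_derive_bessel0 (z * y)) (dz y).
  by rewrite mulrC.
- move=> y.
  have d := is_derive1_comp (is_derive_euler_bessel0 (z * y)) (dz y).
  rewrite (_ : (fun y => y * (z * dbessel0 (z * y))) =
    ((fun y => y * dbessel0 y) \o (fun y => z * y))); last first.
    by apply/funext => x /=; ring.
  by apply: (is_derive_eq d); ring.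
- move=> y; apply: cvgM; first exact: cvg_cst.
  apply: (continuous_comp (f := fun y => z * y)); last exact: cb.
  exact: (is_derive_continuous (dz y)).
- by rewrite mulr1.
Qed.

(** By [dom_fluxE] a vanishing integral would make the flux at [1] vanish; then
    Rolle's theorem for [y g' y], whose derivative is [- g], would give a zero of
    [g] before the first one. *)
Lemma bessel0_eigenfunction_mass z : 0 < z -> bessel0 z = 0 ->
  (forall y, 0 < y < z -> bessel0 y != 0) ->
  ip (fun=> 1) (fun y => bessel0 (z * y)) != 0.
Proof.
move=> z0 bz nz; have dom := bessel0_eigenfunction bz.
have cE : {within `[0, z], continuous (fun y => y * dbessel0 y)}.
  apply: continuous_subspaceT => y.
  exact: (is_derive_continuous (is_derive_euler_bessel0 y)).
have [c] := MVT z0 (fun y _ => is_derive_euler_bessel0 y) cE.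
rewrite in_itv/= => /nz cN; rewrite mul0r !subr0 => EE.
have FE := dom_fluxE dom; rewrite ipZl in FE; last 2 first.
- exact: dom_L2 dom.
- exact: L2_cst.
apply/eqP => ip0; move: FE; rewrite (ipC (fun y => _)) ip0 mulr0 mul1r mulr1 EE.
move/eqP; rewrite mulf_eq0 oppr_eq0 (negbTE cN) /=.
by rewrite gt_eqF.
Qed.

End bessel.

(** * The flux as a function of the degeneracy point *)

Section flux_as_function_of_degeneracy.
Context {R : realType}.
Implicit Types (a c s t z : R) (U V : R -> R -> R).

Lemma evolution_lin c d U V : evolution U -> evolution V ->
  evolution (fun t x => c * U t x + d * V t x).
Proof.
move=> eU eV; split.
- by move=> t t0; apply: L2D; apply: L2Z; [exact: (evo_L2 eU)|exact: (evo_L2 eV)].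
- have L (W : R -> R -> R) : evolution W ->
      \forall t \near (0 : R)^'+, L2 0 (fun x => W t x - W 0 x).
    by move=> eW; near=> t; apply: L2B; exact: (evo_L2 eW).
  apply: (cvg_near (ip_lin_cvg0 c d (L _ eU) (L _ eV) (evo_init eU)
    (evo_init eV))) => //.
  by apply: filterE => t; apply: eq_ip => x _; ring.
- move=> t t0; have [f1 [w1 [dom1 d1]]] := evo_eq eU t0.
  have [f2 [w2 [dom2 d2]]] := evo_eq eV t0.
  exists (fun y => c * f1 y + d * f2 y), (fun y => c * w1 y + d * w2 y).
  by split; [exact: in_domain_lin|exact: L2_derive_lin].
Unshelve. all: by end_near. Qed.

Section flux_slope.
Variables (V : R -> R -> R).
Hypotheses (eV : evolution V) (V0 : forall x, 0 < x < 1 -> V 0 x = 1).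

(** By [evolution_flux] with [c = 1 / s] at the rescaled time [t * s], this is the
    boundary flux of the solution on [(a, 1)] for [s = 1 / (1 - a)]. *)
Definition flux t s := s * derive1 (mass V) (t * s) + mass V (t * s).

(** The derivative in [s] is [s t m'' + (t + 1) m'], hence at least
    [(t (s - 1) - 1) (- m')] by [- m' <= m''], and then at least
    [(t (s - 1) - 1) m] by [m <= - m']. *)
Lemma flux_slope t s1 s2 p : 0 < t -> 0 < s1 -> s1 <= s2 -> 1 <= t * (s1 - 1) ->
  (forall s, s1 <= s <= s2 -> p <= (t * (s1 - 1) - 1) * mass V (t * s)) ->
  p * (s2 - s1) <= flux t s2 - flux t s1.
Proof.
move=> t0 s10 s12 ts1 pm.
pose d s := derive1 (mass V) (t * s) + s * (t * derive1 (derive1 (mass V)) (t * s))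
  + t * derive1 (mass V) (t * s).
have dt s : is_derive s 1 (fun s => t * s) t.
  have e := is_derive_scale (is_derive_id s 1) t.
  by apply: (is_derive_eq e); rewrite mulr1.
have df s : 0 < s -> is_derive s 1 (flux t) (d s).
  move=> s0; have [m2 [dm dm1 _ _]] := mass_convex eV V0 (mulr_gt0 t0 s0).
  have m2E : derive1 (derive1 (mass V)) (t * s) = m2.
    by rewrite derive1E; have [_ ->] := dm1.
  have e0 := is_derive1_comp dm (dt s).
  have e1 := is_derive1_comp dm1 (dt s).
  have e := is_derive_add (is_derive_mul (is_derive_id s 1) e1) e0.
  by apply: (is_derive_eq e); rewrite /d m2E /=; ring.
have dfs s : s \in `]s1, s2[ -> is_derive s 1 (flux t) (d s).
  by rewrite in_itv/= => /andP[s1s _]; apply: df; exact: lt_trans s1s.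
have cf : {within `[s1, s2], continuous (flux t)}.
  apply/continuous_in_subspaceT => s; rewrite inE/= in_itv/= => /andP[s1s _].
  exact: (is_derive_continuous (df s (lt_le_trans s10 s1s))).
have [s s12' ->] := MVT_segment s12 dfs cf.
move: s12'; rewrite in_itv/= => s12'; have /andP[s1s _] := s12'.
have s0 := lt_le_trans s10 s1s.
rewrite ler_wpM2r ?subr_ge0//; apply: le_trans (pm _ s12') _.
have [m2 [dm dm1 mm1 m1m2]] := mass_convex eV V0 (mulr_gt0 t0 s0).
have m2E : derive1 (derive1 (mass V)) (t * s) = m2.
  by rewrite derive1E; have [_ ->] := dm1.
rewrite /d m2E; have := mass_ge0 eV V0 (mulr_gt0 t0 s0).
move: mm1 m1m2; move: (mass V _) (derive1 _ _) => m m1 mm1 m1m2 mge0.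
have h1 : (t * (s1 - 1) - 1) * m <= (t * (s1 - 1) - 1) * (- m1).
  by rewrite ler_wpM2l// subr_ge0.
have tss : t * s1 <= t * s by rewrite ler_pM2l.
have h0 : 0 <= - m1.
  exact: le_trans mm1.
have h2 : t * s * (- m1) <= t * s * m2 by rewrite ler_wpM2l// mulr_ge0// ltW.
have h3 : t * s1 * (- m1) <= t * s * (- m1) by rewrite ler_wpM2r.
lra.
Qed.

End flux_slope.
End flux_as_function_of_degeneracy.

(** * Lipschitz stability of the degeneracy point *)

(** Transported to [(0, 1)], the initial value [x] becomes
    [1 - (1 - a) (1 - y)], so that all the fluxes come from the single evolution
    [V] of the constant [1]; this one is a combination of the transported
    solutions for [a = 0] and [a = 1 / 2]. *)
Lemma solution_family_flux (R : realType) (u : R -> R -> R -> R) :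
  solution_family (fun x : R => x) u ->
  exists V : R -> R -> R,
    [/\ evolution V, forall x, 0 < x < 1 -> V 0 x = 1 &
      forall a t : R, 0 <= a < 1 -> 0 < t ->
        boundary_flux u a t = flux V t (1 - a)^-1].
Proof.
move=> su; pose v a t y : R := u a (a + (1 - a) * y) ((1 - a) * t).
have ev a : 0 <= a < 1 -> evolution (v a).
  by move=> a01; have /andP[_ a1] := a01; exact: (evolution_rescale a1 (su _ a01)).
have v0 a x : 0 <= a < 1 -> 0 < x < 1 -> v a 0 x = 1 - (1 - a) * (1 - x).
  move=> a01 /andP[x0 x1]; have /andP[a0 a1] := a01; have [u0 _ _ _] := su _ a01.
  have La : 0 < 1 - a by rewrite subr_gt0.
  rewrite /v mulr0 u0; first by ring.
  by apply/andP; split; nra.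
have a0 : 0 <= (0 : R) < 1 by rewrite lexx ltr01.
have ah : 0 <= (2^-1 : R) < 1 by apply/andP; split; lra.
pose V t x := 2 * v 2^-1 t x + (-1) * v 0 t x.
have eV : evolution V by apply: evolution_lin; exact: ev.
have V0 x : 0 < x < 1 -> V 0 x = 1.
  by move=> x01; rewrite /V !v0//; field.
exists V; split => // a t a01 t0; have /andP[_ a1] := a01.
have L0 : 0 < 1 - a by rewrite subr_gt0.
have s0 : 0 < t * (1 - a)^-1 by rewrite divr_gt0.
have tE : t = (1 - a) * (t * (1 - a)^-1) by field; exact: lt0r_neq0.
have [f [w [dom dv]]] := evo_eq (ev _ a01) s0.
rewrite [in LHS]tE (boundary_flux_rescale a1 dom).
rewrite (evolution_flux eV V0 (ev _ a01) (fun x => v0 _ x a01) s0 dom dv).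
by rewrite /flux mulrDr mulrA mulVf ?mul1r// lt0r_neq0.
Qed.

Lemma bessel0_first_zero (R : realType) (j1 : R) :
  smallest_positive_zero (@besselJ R 0) j1 ->
  bessel0 ((j1 / 2) ^+ 2) = 0 /\
  forall y, 0 < y < (j1 / 2) ^+ 2 -> bessel0 y != 0.
Proof.
move=> [j0 Jj jmin]; split; first by rewrite -besselJ0E.
move=> y /andP[y0 yz]; apply/eqP => by0.
have s0 : 0 < 2 * Num.sqrt y by rewrite mulr_gt0// sqrtr_gt0.
have : j1 <= 2 * Num.sqrt y.
  apply: jmin => //; rewrite besselJ0E mulrC mulKf//.
  by rewrite sqr_sqrtr// ltW.
rewrite leNgt => /negP; apply.
rewrite mulrC -ltr_pdivlMr// -[ltRHS]ger0_norm ?divr_ge0 ?ltW//.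
by rewrite -sqrtr_sqr ltr_sqrt// exprn_gt0// divr_gt0.
Qed.

Theorem proposition5p5 (R : realType) (j1 : R)
    (hj1 : smallest_positive_zero (@besselJ R 0) j1)
    (alpha beta : R) (halpha : 0 < alpha) (hab : alpha <= beta)
    (hbeta : beta < 1) :
  exists2 T0 : R, 0 < T0 &
    forall t0 t1 : R, T0 <= t0 -> t0 <= t1 ->
    forall u : R -> R -> R -> R, solution_family (fun x : R => x) u ->
      admissible (fun x : R => x) u alpha beta t0 t1 /\
      (forall a1 a2 t : R, alpha <= a1 <= beta -> alpha <= a2 <= beta ->
         t0 <= t <= t1 ->
         `|a2 - a1| <=
           j1 ^+ 2 * expR ((j1 / 2) ^+ 2 * (t1 / (1 - beta))) *
           `|boundary_flux u a2 t - boundary_flux u a1 t|).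
Proof.
have j0 : 0 < j1 by case: hj1.
have [zz znz] := bessel0_first_zero hj1.
set z := (j1 / 2) ^+ 2 in zz znz *.
have z0 : 0 < z by rewrite exprn_gt0// divr_gt0.
have dom := bessel0_eigenfunction zz.
have cN := bessel0_eigenfunction_mass z0 zz znz.
pose phi y : R := bessel0 (z * y).
pose c : R := ip (fun=> 1) phi; pose N : R := ip phi phi.
have c2 : 0 < c ^+ 2 by rewrite exprn_even_gt0.
have j2 : 0 < j1 ^+ 2 by rewrite exprn_gt0.
have N0 : 0 < N.
  have CS := ip_CS (L2_cst 1) (dom_L2 dom); rewrite -/phi -/c -/N in CS.
  rewrite lt_neqAle eq_sym ip_ge0 andbT; apply/eqP => N0.
  by move: CS; rewrite N0 mulr0 leNgt c2.
have b0 : 0 < 1 - beta by rewrite subr_gt0.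
have a1 : alpha < 1 by exact: le_lt_trans hbeta.
have a1' : 0 < 1 - alpha by rewrite subr_gt0.
(* [q] is chosen so that [q] times the lower bound of the mass is
   [e^(- z t s) / j1 ^ 2]; [T0] makes the factor [t (s - 1) - 1] of the slope at
   least [q] for every [s >= 1 / (1 - alpha)] *)
pose q := N / (c ^+ 2 * j1 ^+ 2).
have q0 : 0 < q by apply: divr_gt0 => //; exact: mulr_gt0.
pose T0 := (1 + q) * ((1 - alpha) / alpha).
have T00 : 0 < T0.
  by apply: mulr_gt0; [exact: addr_gt0|exact: divr_gt0].
exists T0 => // t0 t1 Tt0 t01 u su.
have [V [eV V0 fluxE]] := solution_family_flux su.
pose C := j1 ^+ 2 * expR (z * (t1 / (1 - beta))).
have C0 : 0 < C by rewrite mulr_gt0 ?expR_gt0// exprn_gt0.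
have key a b t : alpha <= a -> a <= b -> b <= beta -> t0 <= t <= t1 ->
    b - a <= C * (boundary_flux u b t - boundary_flux u a t).
  move=> aa ab bb /andP[t0t tt1].
  have t00 : 0 < t by rewrite (lt_le_trans T00)// (le_trans Tt0).
  have b1 : 0 < 1 - b by rewrite subr_gt0 (le_lt_trans bb).
  have a1b : 0 < 1 - a by rewrite subr_gt0 (le_lt_trans ab)// -subr_gt0.
  rewrite !fluxE//; last 2 first.
  - by rewrite (le_trans _ aa) ?(ltW halpha)//= -subr_gt0.
  - by rewrite (le_trans _ (le_trans aa ab)) ?(ltW halpha)//= -subr_gt0.
  pose r := alpha / (1 - alpha).
  have r0 : 0 < r by exact: divr_gt0.
  have s1r : r <= (1 - a)^-1 - 1.
    have -> : (1 - a)^-1 - 1 = a / (1 - a) by field; exact: lt0r_neq0.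
    rewrite ler_pM ?(ltW halpha) ?invr_ge0 ?(ltW a1')//.
    by rewrite lef_pV2 ?posrE// lerD2l lerN2.
  have tq : q <= t * ((1 - a)^-1 - 1) - 1.
    have : T0 * r <= t * ((1 - a)^-1 - 1).
      by rewrite ler_pM ?(ltW T00) ?(ltW r0)// (le_trans Tt0).
    have -> : T0 * r = 1 + q.
      by rewrite /T0 /r; field; rewrite !lt0r_neq0.
    lra.
  have sb : (1 - b)^-1 <= (1 - beta)^-1.
    by rewrite lef_pV2 ?posrE// lerD2l lerN2.
  have s12 : (1 - a)^-1 <= (1 - b)^-1.
    by rewrite lef_pV2 ?posrE// lerD2l lerN2.
  have slope : C^-1 * ((1 - b)^-1 - (1 - a)^-1) <=
      flux V t (1 - b)^-1 - flux V t (1 - a)^-1.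
    apply: (flux_slope eV V0) => //; first by rewrite invr_gt0.
      by rewrite -subr_ge0 (le_trans _ tq)// ltW.
    move=> s /andP[s1 s2].
    have s0 : 0 < s by rewrite (lt_le_trans _ s1)// invr_gt0.
    have ts : t * s <= t1 / (1 - beta).
      by rewrite ler_pM ?(ltW t00) ?(ltW s0)// (le_trans s2).
    have := mass_ge eV V0 dom (mulr_gt0 t00 s0).
    rewrite -/phi -/c -/N => mge.
    have eC : C^-1 = (j1 ^+ 2)^-1 * expR (- z * (t1 / (1 - beta))).
      by rewrite /C invfM mulNr expRN.
    have e1 : C^-1 <= (j1 ^+ 2)^-1 * expR (- z * (t * s)).
      rewrite eC ler_wpM2l ?invr_ge0 ?sqr_ge0// ler_expR !mulNr lerN2.
      by rewrite ler_wpM2l// ltW.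
    apply: (le_trans e1); apply: (@le_trans _ _ (q * mass V (t * s))).
      have -> : (j1 ^+ 2)^-1 * expR (- z * (t * s)) =
          (c ^+ 2 * j1 ^+ 2)^-1 * (c ^+ 2 * expR (- z * (t * s))).
        by field; rewrite lt0r_neq0//= -sqrf_eq0 lt0r_neq0.
      have -> : q * mass V (t * s) =
          (c ^+ 2 * j1 ^+ 2)^-1 * (N * mass V (t * s)).
        by rewrite /q mulrAC mulrC.
      by apply: ler_wpM2l => //; rewrite invr_ge0 ltW// mulr_gt0.
    by rewrite ler_wpM2r// (mass_ge0 eV V0)// mulr_gt0.
  apply: (@le_trans _ _ ((1 - b)^-1 - (1 - a)^-1)).
    have -> : (1 - b)^-1 - (1 - a)^-1 = (b - a) / ((1 - a) * (1 - b)).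
      by field; rewrite !lt0r_neq0.
    rewrite ler_peMr ?subr_ge0// invf_ge1 ?mulr_gt0//.
    have a0 : 0 < a := lt_le_trans halpha aa.
    have b0' : 0 < b := lt_le_trans a0 ab.
    nra.
  by rewrite mulrC -ler_pdivrMr// mulrC.
have both a2 a3 t : alpha <= a2 <= beta -> alpha <= a3 <= beta ->
    t0 <= t <= t1 ->
    `|a3 - a2| <= C * `|boundary_flux u a3 t - boundary_flux u a2 t|.
  move=> /andP[aa2 a2b] /andP[aa3 a3b] tt.
  have [a23|/ltW a32] := leP a2 a3.
    rewrite ger0_norm ?subr_ge0//; apply: le_trans (key _ _ _ aa2 a23 a3b tt) _.
    by rewrite ler_wpM2l ?ler_norm// ltW.
  rewrite distrC ger0_norm ?subr_ge0//.
  apply: le_trans (key _ _ _ aa3 a32 a2b tt) _.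
  by rewrite distrC ler_wpM2l ?ler_norm// ltW.
split => //; split.
  exists (fun=> 1); split.
  - by apply: continuous_subspaceT => x; exact: cvg_id.
  - by apply: continuous_subspaceT => x; exact: cvg_cst.
  - by move=> x _; exact: is_derive_id.
exists C^-1; first by rewrite invr_gt0.
move=> a2 a3 t h2 h3 tt; rewrite mulrC ler_pdivrMr// mulrC.
by rewrite (distrC (boundary_flux u a2 t)) distrC; exact: both.
Qed.
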